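(* Let $G$ be a finite group with identity element $e$. (i) Let $t\in G$ with $t^2=e$. Suppose that $P$ is an indecomposable projective direct summand of $(\mathcal{O}_{C_G(t)}){\uparrow^G}$. Then $P$ is irreducible and self-dual and occurs with multiplicity $1$ as a component of $(\mathcal{O}_{C_G(t)}){\uparrow^G}$. In particular $P$ belongs to a real $2$-block of $G$ that has defect zero. (ii) Suppose that $M$ is a projective indecomposable $\mathcal{O}G$-module that belongs to a real $2$-block of $G$ that has defect zero. Then there exists $s\in G$, with $s^2=e$, such that $M$ is a component of $(\mathcal{O}_{C_G(s)}){\uparrow^G}$. Moreover, $s$ is uniquely determined up to conjugacy in $G$.
   Context: Let $k$ be an algebraically closed field of characteristic $2$, and let $R$ be a complete discrete valuation ring of characteristic $0$ with residue field $R/J(R)=k$ and field of fractions $F$, where $F$ is a splitting field for all subgroups of the finite groups considered. $\mathcal{O}$ denotes either of the rings $k$ or $R$. Modules are right modules, finitely generated and free over $\mathcal{O}$. When $\mathcal{O}=R$, ''irreducible'' for an $RG$-module $P$ means that $F\otimes_R P$ is an irreducible $FG$-module. $P$ is self-dual if $P\cong \mathrm{Hom}_{\mathcal{O}}(P,\mathcal{O})$ as $\mathcal{O}G$-modules. For $H\le G$, $\mathcal{O}_H$ is the trivial $\mathcal{O}H$-module (of $\mathcal{O}$-rank $1$) and $N{\uparrow^G}$ is the induction to $G$ of an $\mathcal{O}H$-module $N$. A component of a module is an indecomposable direct summand; its multiplicity is the number of times its isomorphism type occurs in a decomposition into indecomposables (well defined by the Krull-Schmidt theorem). A block of $\mathcal{O}G$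 (a $2$-block of $G$) is an indecomposable $\mathcal{O}$-algebra direct summand $B$ of $\mathcal{O}G$. For $\mathcal{O}=k$ it has defect zero if it is a simple $k$-algebra; for $\mathcal{O}=R$ it has defect zero if $k\otimes_R B$ is a simple $k$-algebra (equivalently, in both cases, its defect groups are trivial). Put $B^o=\{x^\sigma\mid x\in B\}$, where $\sigma$ is the $\mathcal{O}$-linear map on $\mathcal{O}G$ with $g^\sigma=g^{-1}$ for $g\in G$; $B$ is real if $B=B^o$ (equivalently, the set of ordinary irreducible characters of the block is closed under complex conjugation). *)

(* Defs.v *)
From HB Require Import structures.
From mathcomp Require Import all_boot all_order all_algebra all_fingroup.
From mathcomp Require Import all_solvable all_field mxrepresentation.
From mathcomp Require Import classical_sets.

Set Implicit Arguments.
Unset Strict Implicit.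
Unset Printing Implicit Defensive.

Import GroupScope GRing.Theory.
Local Open Scope ring_scope.

(* Convention: a finite group G is a [finGroupType]; as a group in the sense of
   mxrepresentation it is [set: G]%G.  A finitely generated O-free right
   OG-module of rank n is a [gmod O G n]: a matrix representation acting on row
   vectors from the right. *)
Notation gmod O G n := (mx_representation O [set: G]%G n).

Section Modules.
Variables (O : comUnitRingType) (gT : finGroupType).

Definition mod_iso (G : {group gT}) n1 n2 (V : mx_representation O G n1)
    (W : mx_representation O G n2) : Prop :=
  exists (A : 'M[O]_(n1, n2)) (B : 'M[O]_(n2, n1)),
    [/\ A *m B = 1%:M, B *m A = 1%:M &
        {in G, forall g, V g *m A = A *m W g}].

Section DirectSum.
Variables (G : {group gT}) (r : nat) (d : 'I_r -> nat).
Variable V : forall i, mx_representation O G (d i).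

Definition dsum_mx (g : gT) : 'M[O]_(\sum_i d i) := \mxdiag_i V i g.

Lemma dsum_mx_repr : mx_repr G dsum_mx.
Proof.
split=> [|g h Gg Gh]; rewrite /dsum_mx.
  by rewrite -mxdiagZ; apply: eq_mxdiag => i; rewrite repr_mx1.
rewrite mul_mxdiag_mxblock; apply: eq_mxblock => i j.
case: eqP => [e|ne]; last by rewrite mulmx0.
by case: j / e; rewrite !conform_mx_id repr_mxM.
Qed.

Definition dsum : mx_representation O G (\sum_i d i) :=
  MxRepresentation dsum_mx_repr.
End DirectSum.

Section DirectSum2.
Variables (G : {group gT}) (n1 n2 : nat).
Variables (V : mx_representation O G n1) (W : mx_representation O G n2).

Definition dadd_mx (g : gT) : 'M[O]_(n1 + n2) := block_mx (V g) 0 0 (W g).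

Lemma dadd_mx_repr : mx_repr G dadd_mx.
Proof.
split=> [|g h Gg Gh]; rewrite /dadd_mx.
  by rewrite !repr_mx1 -scalar_mx_block.
by rewrite mulmx_block !mulmx0 !mul0mx !addr0 !add0r !repr_mxM.
Qed.

Definition dadd : mx_representation O G (n1 + n2) :=
  MxRepresentation dadd_mx_repr.
End DirectSum2.

(* The complement W is O-free by definition; this loses nothing when O is local,
   since direct summands of free modules of finite rank are then free. *)
Definition direct_summand (G : {group gT}) n (P : mx_representation O G n)
    m (M : mx_representation O G m) : Prop :=
  exists (q : nat) (W : mx_representation O G q), mod_iso M (dadd P W).

Definition indecomposable (G : {group gT}) n (P : mx_representation O G n) :
    Prop :=
  (0 < n)%N /\
  forall n1 n2 (V : mx_representation O G n1) (W : mx_representation O G n2),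
    mod_iso P (dadd V W) -> n1 = 0%N \/ n2 = 0%N.

Definition component (G : {group gT}) n (P : mx_representation O G n)
    m (M : mx_representation O G m) : Prop :=
  indecomposable P /\ direct_summand P M.

Definition projective (G : {group gT}) n (P : mx_representation O G n) : Prop :=
  exists r : nat, direct_summand P (dsum (fun _ : 'I_r => regular_repr O G)).

Definition decomposition (G : {group gT}) m (M : mx_representation O G m)
    r (d : 'I_r -> nat) (V : forall i, mx_representation O G (d i)) : Prop :=
  (forall i, indecomposable (V i)) /\ mod_iso M (dsum V).

(* Every decomposition of M into indecomposables has exactly c terms isomorphic
   to P; the first clause excludes vacuity. *)
Definition multiplicity (G : {group gT}) n (P : mx_representation O G n)
    m (M : mx_representation O G m) (c : nat) : Prop :=
  (exists r (d : 'I_r -> nat) (V : forall i, mx_representation O G (d i)),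
     decomposition M V) /\
  forall r (d : 'I_r -> nat) (V : forall i, mx_representation O G (d i)),
    decomposition M V ->
    exists A : {set 'I_r}, #|A| = c /\ forall i, i \in A <-> mod_iso (V i) P.

(* Hom_O(V, O) with the right action (f g)(v) = f (v g^-1), in the dual basis. *)
Section Dual.
Variables (G : {group gT}) (n : nat) (V : mx_representation O G n).

Definition dual_mx (g : gT) : 'M[O]_n := (V g^-1%g)^T.

Lemma dual_mx_repr : mx_repr G dual_mx.
Proof.
split=> [|g h Gg Gh]; rewrite /dual_mx; first by rewrite invg1 repr_mx1 trmx1.
by rewrite invMg repr_mxM ?groupV // trmx_mul.
Qed.

Definition dual : mx_representation O G n := MxRepresentation dual_mx_repr.
End Dual.

Definition self_dual (G : {group gT}) n (V : mx_representation O G n) : Prop :=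
  mod_iso V (dual V).

Section Trivial.
Variable G : {group gT}.

Lemma triv_mx_repr : mx_repr G (fun _ : gT => 1%:M : 'M[O]_1).
Proof. by split=> // g h _ _; rewrite mulmx1. Qed.

Definition trivial_mod : mx_representation O G 1 :=
  MxRepresentation triv_mx_repr.
End Trivial.

(* The module N (x)_{OH} OG: if x_i is the representative of the i-th right coset
   of H, then (v (x) x_i) g = v h (x) x_j where x_i g = h x_j with h in H. *)
Section Induction.
Variables (H : {group gT}) (n : nat) (N : mx_representation O H n).

Definition coset_rep (i : 'I_#|rcosets H [set: gT]|) : gT := repr (enum_val i).

Definition ind_mx (g : gT) : 'M[O]_(\sum_(i < #|rcosets H [set: gT]|) n) :=
  \mxblock_(i, j)
    (let h := (coset_rep i * g * (coset_rep j)^-1)%g in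
     if h \in H then N h else 0).

Lemma coset_repK i : (H :* coset_rep i)%g = enum_val i.
Proof.
have /rcosetsP[x _ def_x] := enum_valP i.
by rewrite /coset_rep def_x rcoset_repr.
Qed.

Lemma coset_repV i j :
  ((coset_rep i * (coset_rep j)^-1)%g \in H) = (i == j).
Proof.
rewrite -mem_rcoset -(inj_eq enum_val_inj) -!coset_repK.
by apply/idP/eqP => [/rcoset_eqP|<-] //; apply: rcoset_refl.
Qed.

Lemma coset_rep_ex x : exists i, (x * (coset_rep i)^-1)%g \in H.
Proof.
have Hx: (H :* x)%g \in rcosets H [set: gT].
  by apply/rcosetsP; exists x; rewrite ?inE.
exists (enum_rank_in Hx (H :* x)%g).
by rewrite -mem_rcoset coset_repK enum_rankK_in // rcoset_refl.
Qed.

Lemma ind_mx_repr : mx_repr [set: gT] ind_mx.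
Proof.
split=> [|g h _ _]; rewrite /ind_mx.
  rewrite -mxdiagZ; apply: eq_mxblock => i j; rewrite mulg1 coset_repV.
  case: (eqVneq i j) => [<-|//].
  by rewrite conform_mx_id mulgV repr_mx1.
rewrite mul_mxblock; apply: eq_mxblock => i j /=.
have [l Hl] := coset_rep_ex (coset_rep i * g)%g.
have defM : (coset_rep i * (g * h) * (coset_rep j)^-1 =
   (coset_rep i * g * (coset_rep l)^-1) *
   (coset_rep l * h * (coset_rep j)^-1))%g.
  by rewrite !mulgA mulgKV.
rewrite (bigD1 l) //= Hl big1 ?addr0 => [|m m'l].
  by rewrite defM groupMl //; case: ifP => Hh; rewrite ?mulmx0 // repr_mxM.
case: ifP => [Hm|]; last by rewrite mul0mx.
case/eqP: m'l; apply/eqP; rewrite -coset_repV.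
have := groupM (groupVr Hm) Hl.
by rewrite !invMg !invgK !mulgA; congr (_ \in H); rewrite -!mulgA !mulKg.
Qed.

Definition induced : gmod O gT (\sum_(i < #|rcosets H [set: gT]|) n) :=
  MxRepresentation ind_mx_repr.
End Induction.

End Modules.

(* F (x)_O P is irreducible, where F is the field of fractions of O. *)
Definition frac_irreducible (O : idomainType) (gT : finGroupType)
    (G : {group gT}) n (P : mx_representation O G n) : Prop :=
  mx_irreducible (map_repr (@tofrac O) P).

(* The group algebra OG: coefficient functions, multiplied by convolution. *)
Definition galg (O : comUnitRingType) (G : finGroupType) := {ffun G -> O^o}.

Section GroupAlgebra.
Variables (O : comUnitRingType) (G : finGroupType).
Implicit Types x y z : galg O G.

HB.instance Definition _ := GRing.Lmodule.copy (galg O G) {ffun G -> O^o}.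

Definition galg_one : galg O G := [ffun g => (g == 1%g)%:R].
Definition galg_mul x y : galg O G :=
  [ffun g => \sum_(h : G) (x h * y (h^-1 * g)%g : O)].

Lemma galg_mulA : associative galg_mul.
Proof.
move=> x y z; apply/ffunP=> g; rewrite !ffunE.
under eq_bigr => h _ do rewrite ffunE mulr_sumr.
under [RHS]eq_bigr => h _ do rewrite ffunE mulr_suml.
rewrite [RHS]exchange_big /=; apply: eq_bigr => h _.
rewrite (reindex_inj (mulgI h^-1%g)) /=; apply: eq_bigr => l _.
by rewrite mulrA invMg invgK -!mulgA mulKVg.
Qed.

Lemma galg_mul1l : left_id galg_one galg_mul.
Proof.
move=> x; apply/ffunP=> g; rewrite !ffunE (bigD1 1%g) //= ffunE eqxx mul1r.
rewrite invg1 mul1g big1 ?addr0 // => h h1.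
by rewrite ffunE (negPf h1) mul0r.
Qed.

Lemma galg_mul1r : right_id galg_one galg_mul.
Proof.
move=> x; apply/ffunP=> g; rewrite !ffunE (bigD1 g) //= ffunE mulVg eqxx mulr1.
rewrite big1 ?addr0 // => h hg.
by rewrite ffunE -eq_mulVg1 (negPf hg) mulr0.
Qed.

Lemma galg_mulDl : left_distributive galg_mul +%R.
Proof.
move=> x y z; apply/ffunP=> g; rewrite !ffunE -big_split /=.
by apply: eq_bigr => h _; rewrite ffunE mulrDl.
Qed.

Lemma galg_mulDr : right_distributive galg_mul +%R.
Proof.
move=> x y z; apply/ffunP=> g; rewrite !ffunE -big_split /=.
by apply: eq_bigr => h _; rewrite ffunE mulrDr.
Qed.

Lemma galg_one_neq0 : galg_one != 0.
Proof.
apply/eqP => /ffunP/(_ 1%g); rewrite !ffunE eqxx => /eqP.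
by rewrite oner_eq0.
Qed.

HB.instance Definition _ := GRing.Zmodule_isNzRing.Build (galg O G)
  galg_mulA galg_mul1l galg_mul1r galg_mulDl galg_mulDr galg_one_neq0.

Lemma galg_scaleAl (a : O) x y : a *: (x * y) = (a *: x) * y.
Proof.
apply/ffunP=> g; rewrite !ffunE scaler_sumr.
by apply: eq_bigr => h _; rewrite ffunE -scalerAl.
Qed.

HB.instance Definition _ :=
  GRing.Lmodule_isLalgebra.Build O (galg O G) galg_scaleAl.

Lemma galg_scaleAr (a : O) x y : a *: (x * y) = x * (a *: y).
Proof.
apply/ffunP=> g; rewrite !ffunE scaler_sumr.
by apply: eq_bigr => h _; rewrite ffunE -scalerAr.
Qed.

HB.instance Definition _ :=
  GRing.Lalgebra_isAlgebra.Build O (galg O G) galg_scaleAr.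

Definition galg_inv x : galg O G := [ffun g => x g^-1%g].

Definition galg_act n (V : gmod O G n) x : 'M[O]_n :=
  \sum_(g : G) (x g : O) *: V g.
End GroupAlgebra.

Definition galg_map (O O' : comUnitRingType) (f : {rmorphism O -> O'})
    (G : finGroupType) (x : galg O G) : galg O' G := [ffun g => f (x g)].

Local Open Scope classical_set_scope.

Section Blocks.
Variables (O : comUnitRingType) (A : algType O).
Implicit Types B C I : set A.

(* C is meant to be a subalgebra, possibly with a different identity element
   from that of A. *)
Definition ideal_of C I : Prop :=
  [/\ I `<=` C, I 0, (forall x y, I x -> I y -> I (x + y)),
      (forall (a : O) x, I x -> I (a *: x)) &
      (forall c x, C c -> I x -> I (c * x) /\ I (x * c))].

Definition algebra_dsum C B1 B2 : Prop :=
  [/\ ideal_of C B1, ideal_of C B2,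
      (forall c, C c -> exists b1 b2, [/\ B1 b1, B2 b2 & c = b1 + b2]) &
      B1 `&` B2 = [set 0]].

Definition algebra_indecomposable B : Prop :=
  B <> [set 0] /\
  forall B1 B2, algebra_dsum B B1 B2 -> B1 = [set 0] \/ B2 = [set 0].

Definition is_block B : Prop :=
  (exists B', algebra_dsum setT B B') /\ algebra_indecomposable B.

Definition simple_algebra B : Prop :=
  B <> [set 0] /\ forall I, ideal_of B I -> I = [set 0] \/ I = B.
End Blocks.

Section BlocksOfGroups.
Variables (O : comUnitRingType) (G : finGroupType).

Definition real_block (B : set (galg O G)) : Prop :=
  B = [set galg_inv x | x in B].

Definition belongs_to n (V : gmod O G n) (B : set (galg O G)) : Prop :=
  exists e : galg O G,
    [/\ B e, (forall b, B b -> e * b = b /\ b * e = b) &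
        galg_act V e = 1%:M].
End BlocksOfGroups.

(* For a block B of RG, a direct summand of RG as an R-module, k (x)_R B is
   identified with the image of B under the reduction RG -> kG. *)
Definition reduced_block (R k : comUnitRingType) (red : {rmorphism R -> k})
    (G : finGroupType) (B : set (galg R G)) : set (galg k G) :=
  [set galg_map red x | x in B].

Section CompleteDVR.
Variable R : idomainType.

Definition is_uniformizer (p : R) : Prop :=
  [/\ p != 0, p \isn't a GRing.unit &
      forall x : R, x != 0 ->
        exists (u : R) (m : nat), u \is a GRing.unit /\ x = u * p ^+ m].

Definition is_dvr : Prop := exists p : R, is_uniformizer p.

(* Congruence modulo J(R)^m = (p^m). *)
Definition adic_cong (p : R) (m : nat) (x y : R) : Prop :=
  exists c : R, x - y = c * p ^+ m.

Definition adic_complete (p : R) : Prop :=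
  forall u : nat -> R,
    (forall m, exists N, forall i j, (N <= i)%N -> (N <= j)%N ->
       adic_cong p m (u i) (u j)) ->
    exists l : R, forall m, exists N, forall i, (N <= i)%N ->
       adic_cong p m (u i) l.

Definition is_complete_dvr : Prop :=
  is_dvr /\ forall p : R, is_uniformizer p -> adic_complete p.

(* [red] induces an isomorphism R / J(R) = k; J(R) consists of the nonunits
   since R is local. *)
Definition is_residue_map (k : fieldType) (red : {rmorphism R -> k}) : Prop :=
  (forall a : k, exists x : R, red x = a) /\
  (forall x : R, red x = 0 <-> x \isn't a GRing.unit).
End CompleteDVR.

(* Main.v *)
Require Import Defs.
From HB Require Import structures.
From mathcomp Require Import all_boot all_order all_algebra all_fingroup.
From mathcomp Require Import all_solvable all_field mxrepresentation.
From mathcomp Require Import classical_sets boolp zify ring.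

Set Implicit Arguments.
Unset Strict Implicit.
Unset Printing Implicit Defensive.

Import GroupScope GRing.Theory.
Local Open Scope ring_scope.

(** Let u be a vector of a projective kG-module P, in characteristic 2, that is
fixed by C(t), where t has square 1; such vectors are the columns of the maps
from P to the module induced from the trivial module of C(t).  Projectivity
makes u the sum of the P(h)y over h in C(t), for some y.  Expand

  sum over g in G of (v P(tg) y) (v P(gt) y).

The involution g |-> tgt permutes the terms, so only g in C(t) contributes, and
the sum is (vu)^2; on the other hand it is v P(t) S v^T, where S is the sum of
the P(g) Y P(g)^T with Y = y (P(t)y)^T, a G-invariant bilinear form that is a
trace from the trivial subgroup.  If P is a summand of the induced module, then
some u does not vanish on a given simple submodule N of P, hence S does not
vanish on N.  A nonzero invariant form on N identifies N with its dual, and as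
this form is a trace, so is the identity of N (form_higman): N is projective,
hence injective, and equals P when P is indecomposable.  This is submodule_form,
which yields irreducibility and self-duality at once.

Suppose now that N is irreducible with such a form S.  It is absolutely
irreducible, so sum of N(g) X N(g)^-1 = c tr(X) for a scalar c, nonzero by
projectivity.  These Schur relations evaluate the same kind of sum in closed
form: for t and z of square 1,

  sum of (v N(tg) y) (v N(gz) y) = c (y^T N(z)^T S^-1 y) (v N(t) S v^T).

For z = t the left side is (vu)^2, so the fixed vectors of C(t) form at most a
line (form_fixed_unique: multiplicity at most 1); if z is not conjugate to t,
the involution g |-> tgz has no fixed points and the sum is 0, so at most one
conjugacy class has nonzero fixed vectors (form_fixed_conj: uniqueness of s).
That some class has one (form_fixed_exists) follows from pairing g with g^-1 in
the sum of (v S^-1 N(g)^-1 v^T) (v N(g) S v^T), which equals c (v v^T)^2.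

The block of such a module is the matrix algebra spanned by the elements
sum of tr(X N(g)^-1) g, and transposition with respect to S shows that it is
real.  Conversely, if a simple algebra B is an ideal of kG with identity e and
N is a simple module on which e acts as 1, then B acts faithfully on N and
contains the element of this kind with X = 1, which forces c to be nonzero; and
if e is symmetric, the character of N takes equal values at g and g^-1, which
produces a nonzero form (simple_block_schur, simple_block_form).

All of this passes from k to R.  Homomorphisms out of projective modules lift
because they are traces, idempotents lift because R is complete, and a matrix
over R is invertible when its reduction is.  Both coefficient rings are treated
at once, as a domain O with a map to k along which idempotent matrices lift
(idempotent_lifting); for O = k this map is the identity. *)

(** * Traces from the trivial subgroup *)

Section GroupTrace.
Variables (O : comUnitRingType) (G : finGroupType).

Lemma gmodM n (V : gmod O G n) g h : V (g * h)%g = V g *m V h.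
Proof. by rewrite repr_mxM ?inE. Qed.

Lemma gmodKV n (V : gmod O G n) g : V g^-1%g *m V g = 1%:M.
Proof. by rewrite -gmodM mulVg repr_mx1. Qed.

Lemma gmodVK n (V : gmod O G n) g : V g *m V g^-1%g = 1%:M.
Proof. by rewrite -gmodM mulgV repr_mx1. Qed.

Definition intertwines n m (V : gmod O G n) (W : gmod O G m)
    (A : 'M[O]_(n, m)) : Prop :=
  forall g, V g *m A = A *m W g.

Lemma intertwines1 n (V : gmod O G n) : intertwines V V 1%:M.
Proof. by move=> g; rewrite mulmx1 mul1mx. Qed.

Lemma intertwines_mul n m q (V : gmod O G n) (W : gmod O G m) (U : gmod O G q)
    (A : 'M[O]_(n, m)) (B : 'M[O]_(m, q)) :
  intertwines V W A -> intertwines W U B -> intertwines V U (A *m B).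
Proof. by move=> hA hB g; rewrite mulmxA hA -!mulmxA hB. Qed.

Lemma intertwines_inv n m (V : gmod O G n) (W : gmod O G m)
    (A : 'M[O]_(n, m)) (B : 'M[O]_(m, n)) :
  A *m B = 1%:M -> B *m A = 1%:M -> intertwines V W A -> intertwines W V B.
Proof.
move=> AB BA hA g.
by rewrite -[W g]mul1mx -BA -!mulmxA (mulmxA A) -hA -!mulmxA AB mulmx1.
Qed.

Lemma mod_isoP n m (V : gmod O G n) (W : gmod O G m) :
  mod_iso V W <-> exists (A : 'M[O]_(n, m)) (B : 'M[O]_(m, n)),
    [/\ A *m B = 1%:M, B *m A = 1%:M & intertwines V W A].
Proof.
split=> -[A [B [AB BA hA]]]; exists A, B; split=> // g.
by apply: hA; rewrite inE.
Qed.

Definition gtrace n m (V : gmod O G n) (W : gmod O G m) (X : 'M[O]_(n, m)) :=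
  \sum_(g : G) V g *m X *m W g^-1%g.

Lemma gtraceP n m (V : gmod O G n) (W : gmod O G m) X :
  intertwines V W (gtrace V W X).
Proof.
move=> h; rewrite /gtrace mulmx_sumr mulmx_suml.
rewrite [RHS](reindex_inj (mulgI h)); apply: eq_bigr => g _ /=.
by rewrite gmodM invMg gmodM !mulmxA -[in RHS](mulmxA _ (W h^-1%g)) gmodKV mulmx1.
Qed.

Lemma gtrace_mull q n m (U : gmod O G q) (V : gmod O G n) (W : gmod O G m)
    (A : 'M[O]_(q, n)) X :
  intertwines U V A -> A *m gtrace V W X = gtrace U W (A *m X).
Proof.
move=> hA; rewrite /gtrace mulmx_sumr; apply: eq_bigr => g _.
by rewrite !mulmxA hA.
Qed.

Lemma gtrace_mulr n m q (V : gmod O G n) (W : gmod O G m) (U : gmod O G q)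
    (A : 'M[O]_(m, q)) X :
  intertwines W U A -> gtrace V W X *m A = gtrace V U (X *m A).
Proof.
move=> hA; rewrite /gtrace mulmx_suml; apply: eq_bigr => g _.
by rewrite -!mulmxA hA.
Qed.

(** Higman's criterion for projectivity, the form in which projectivity is used
throughout: it turns every homomorphism from or to the module into a trace, it
passes to retracts, and it survives reduction of the coefficients. *)
Definition higman n (V : gmod O G n) : Prop := exists T, gtrace V V T = 1%:M.

Lemma higman_retract n m (V : gmod O G n) (W : gmod O G m) A B :
  intertwines V W A -> intertwines W V B -> A *m B = 1%:M ->
  higman W -> higman V.
Proof.
move=> hA hB AB [T T1]; exists (A *m T *m B).
by rewrite -(gtrace_mulr V _ hB) -(gtrace_mull W T hA) T1 mulmx1.
Qed.

(** Inclusions and projections of a two-term decomposition; together with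
mod_iso_dsum this replaces block matrices by equations between maps. *)
Lemma mod_iso_dadd m n1 n2 (M : gmod O G m) (V : gmod O G n1) (W : gmod O G n2) :
  mod_iso M (dadd V W) -> exists a b a' b',
    [/\ intertwines V M a, intertwines M V b, intertwines W M a' &
        intertwines M W b'] /\
    [/\ a *m b = 1%:M, a' *m b' = 1%:M, a *m b' = 0, a' *m b = 0 &
        b *m a + b' *m a' = 1%:M].
Proof.
move=> /mod_isoP[A [B [AB BA hA]]].
have hB := intertwines_inv AB BA hA.
exists (usubmx B), (lsubmx A), (dsubmx B), (rsubmx A).
move: AB BA; rewrite -{1}[A]hsubmxK -{1}[B]vsubmxK mul_row_col => AB.
rewrite -{1}[A]hsubmxK -{1}[B]vsubmxK mul_col_row scalar_mx_block.
move=> /eq_block_mx[e1 e2 e3 e4]; split=> //; split=> g.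
- have := hB g; rewrite /= /dadd_mx -{1}[B]vsubmxK -{3}[B]vsubmxK mul_block_col mul_col_mx.
  by rewrite !mul0mx addr0 add0r => /eq_col_mx[].
- have := hA g; rewrite /= /dadd_mx -{1}[A]hsubmxK -{3}[A]hsubmxK mul_row_block mul_mx_row.
  by rewrite !mulmx0 addr0 add0r => /eq_row_mx[].
- have := hB g; rewrite /= /dadd_mx -{1}[B]vsubmxK -{3}[B]vsubmxK mul_block_col mul_col_mx.
  by rewrite !mul0mx addr0 add0r => /eq_col_mx[].
have := hA g; rewrite /= /dadd_mx -{1}[A]hsubmxK -{3}[A]hsubmxK mul_row_block mul_mx_row.
by rewrite !mulmx0 addr0 add0r => /eq_row_mx[].
Qed.

Lemma direct_summand_retract n m (P : gmod O G n) (M : gmod O G m) :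
  direct_summand P M -> exists A B,
    [/\ intertwines P M A, intertwines M P B & A *m B = 1%:M].
Proof.
move=> [q [W /mod_iso_dadd[a [b [_ [_ [[ha hb _ _] [ab _ _ _ _]]]]]]]].
by exists a, b.
Qed.

(** The idempotent of the coordinate at the identity is a witness: its conjugates
are the coordinate idempotents, which add up to 1. *)
Lemma higman_regular : higman (regular_repr O [set: G]%G).
Proof.
pose i1 := gring_index [set: G]%G 1%g.
exists (delta_mx i1 i1); apply/matrixP=> i j; rewrite /gtrace summxE.
have E (g : G) : (regular_mx O [set: G]%G g *m delta_mx i1 i1
    *m regular_mx O [set: G]%G g^-1%g) i j =
    ((enum_val i * g == 1)%g && (enum_val j == g^-1)%g)%:R.
  have inj1 h l : (l == gring_index [set: G]%G h) = (enum_val l == h).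
    apply/eqP/eqP=> [->|<-]; first by rewrite gring_indexK ?inE.
    by rewrite gring_valK.
  rewrite mxE (bigD1 i1) //= big1 ?addr0 => [|l l1]; last first.
    rewrite mxE big1 ?mul0r // => m _.
    by rewrite [delta_mx _ _ _ _]mxE (negPf l1) andbF mulr0.
  rewrite mxE (bigD1 i1) //= big1 ?addr0 => [|l l1]; last first.
    by rewrite [delta_mx _ _ _ _]mxE (negPf l1) mulr0.
  rewrite !mxE !eqxx mulr1 /= gring_indexK ?inE // mul1g inj1.
  by rewrite eq_sym inj1 gring_indexK ?inE // -natrM mulnb.
under eq_bigr do rewrite E.
rewrite (bigD1 (enum_val i)^-1%g) //= mulgV eqxx invgK big1 => [|g gi].
  by rewrite addr0 mxE (inj_eq enum_val_inj) eq_sym.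
by rewrite -eq_invg_mul eq_sym (negPf gi).
Qed.

Lemma dsum_family r (d : 'I_r -> nat) (V : forall i, gmod O G (d i)) :
  exists (a : forall i, 'M[O]_(d i, \sum_i d i))
         (b : forall i, 'M[O]_(\sum_i d i, d i)),
  [/\ forall i, intertwines (V i) (dsum V) (a i),
      forall i, intertwines (dsum V) (V i) (b i),
      \sum_i b i *m a i = 1%:M,
      forall i, a i *m b i = 1%:M &
      forall i j, i != j -> a i *m b j = 0].
Proof.
exists (submxcol 1%:M); exists (submxrow 1%:M); split.
- move=> i g; rewrite submxcol_mul mul1mx.
  rewrite -[X in _ = submxcol X _]mulmx1.
  rewrite -[X in _ = submxcol (_ *m X) _]submxcolK /= /dsum_mx.
  by rewrite mul_mxdiag_mxcol mxcolK.
- move=> i g; rewrite mul_submxrow mulmx1.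
  rewrite -[X in submxrow X _ = _]mul1mx.
  rewrite -[X in submxrow (X *m _) _ = _]submxrowK /= /dsum_mx.
  by rewrite mul_mxrow_mxdiag mxrowK.
- by rewrite -mul_mxrow_mxcol submxcolK submxrowK mulmx1.
- move=> i; rewrite mul_submxrow submxcol_mul mulmx1 -submxblockEv.
  by rewrite -mxdiagZ submxblock_diag.
move=> i j ij; rewrite mul_submxrow submxcol_mul mulmx1 -submxblockEv.
by rewrite -mxdiagZ mxblockK (negPf ij).
Qed.

Lemma mod_iso_dsum m (M : gmod O G m) r (d : 'I_r -> nat)
    (V : forall i, gmod O G (d i)) :
  mod_iso M (dsum V) <->
  exists (a : forall i, 'M[O]_(d i, m)) (b : forall i, 'M[O]_(m, d i)),
  [/\ forall i, intertwines (V i) M (a i),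
      forall i, intertwines M (V i) (b i),
      \sum_i b i *m a i = 1%:M,
      forall i, a i *m b i = 1%:M &
      forall i j, i != j -> a i *m b j = 0].
Proof.
split.
  move=> /mod_isoP[A [B [AB BA hA]]].
  have hB := intertwines_inv AB BA hA.
  have [a [b [ha hb ba ab1 ab0]]] := dsum_family V.
  exists (fun i => a i *m B), (fun i => A *m b i); split.
  - by move=> i; apply: intertwines_mul hB.
  - by move=> i; apply: intertwines_mul (hb i).
  - transitivity (A *m (\sum_i b i *m a i) *m B); last by rewrite ba mulmx1.
    rewrite mulmx_sumr mulmx_suml; apply: eq_bigr => i _.
    by rewrite !mulmxA.
  - by move=> i; rewrite mulmxA -(mulmxA _ B) BA mulmx1.
  - by move=> i j ij; rewrite mulmxA -(mulmxA _ B) BA mulmx1 ab0.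
move=> [a [b [ha hb ba ab1 ab0]]]; apply/mod_isoP.
exists (\mxrow_i b i), (\mxcol_i a i); split.
- by rewrite mul_mxrow_mxcol.
- rewrite mul_mxcol_mxrow -mxdiagZ; apply: eq_mxblock => i j.
  case: eqVneq => [<-|ij]; last exact: ab0.
  by rewrite conform_mx_id.
move=> g; rewrite mul_mxrow /= /dsum_mx mul_mxrow_mxdiag.
by apply: eq_mxrow => i; apply: hb.
Qed.

Lemma projective_higman n (P : gmod O G n) : projective P -> higman P.
Proof.
move=> [r /direct_summand_retract[A [B [hA hB AB]]]].
apply: (higman_retract hA hB AB) => {hA hB AB A B}.
have [a [b [ha hb ba _ _]]] := dsum_family (fun _ : 'I_r => regular_repr O [set: G]%G).
have [T T1] := higman_regular.
exists (\sum_i b i *m T *m a i); rewrite -{}ba.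
under [RHS]eq_bigr => i _.
  rewrite -[b i]mulmx1 -T1 (gtrace_mull _ _ (hb i)) (gtrace_mulr _ _ (ha i)).
  over.
rewrite /gtrace exchange_big /=; apply: eq_bigr => g _.
by rewrite -mulmx_suml -mulmx_sumr.
Qed.
End GroupTrace.

(** * Schur relations *)

Lemma mul_mx_delta (O : comNzRingType) m n p (A : 'M[O]_(m, n)) (i : 'I_n)
    (j : 'I_p) k l : (A *m delta_mx i j) k l = A k i *+ (l == j).
Proof.
rewrite mxE (bigD1 i) //= big1 ?addr0 => [|q qi].
  by rewrite mxE eqxx /= mulr_natr.
by rewrite mxE (negPf qi) mulr0.
Qed.

Lemma mul_delta_mxE (O : comNzRingType) m n p (A : 'M[O]_(n, p)) (i : 'I_m)
    (j : 'I_n) k l : (delta_mx i j *m A) k l = A j l *+ (k == i).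
Proof.
rewrite mxE (bigD1 j) //= big1 ?addr0 => [|q qi].
  by rewrite mxE eqxx andbT mulr_natl.
by rewrite mxE (negPf qi) andbF mul0r.
Qed.

Lemma central_scalar_mx (O : comNzRingType) n (Z : 'M[O]_n) i0 :
  (forall Y, Z *m Y = Y *m Z) -> Z = (Z i0 i0)%:M.
Proof.
move=> cZ; apply/matrixP=> k i; have := cZ (delta_mx i i0).
move/matrixP/(_ k i0); rewrite mul_mx_delta mul_delta_mxE eqxx mulr1n => ->.
by rewrite !mxE.
Qed.

Section Schur.
Variables (O : comUnitRingType) (G : finGroupType) (n : nat) (N : gmod O G n).
Implicit Types (X Y : 'M[O]_n) (x y : galg O G).

Lemma galg_act0 : galg_act N 0 = 0.
Proof. by rewrite /galg_act big1 // => g _; rewrite ffunE scale0r. Qed.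

Lemma galg_actD x y : galg_act N (x + y) = galg_act N x + galg_act N y.
Proof.
by rewrite /galg_act -big_split; apply: eq_bigr => g _; rewrite ffunE scalerDl.
Qed.

Lemma galg_actZ a x : galg_act N (a *: x) = a *: galg_act N x.
Proof.
by rewrite /galg_act scaler_sumr; apply: eq_bigr => g _; rewrite ffunE scalerA.
Qed.

Lemma galg_actM x y : galg_act N (x * y) = galg_act N x *m galg_act N y.
Proof.
rewrite /galg_act mulmx_suml.
under eq_bigr => g _ do rewrite ffunE scaler_suml.
rewrite exchange_big; apply: eq_bigr => h _ /=.
rewrite (reindex_inj (mulgI h)) mulmx_sumr; apply: eq_bigr => g _ /=.
by rewrite mulKg gmodM -scalemxAl -scalemxAr scalerA.
Qed.

(** For a module over a field this is absolute irreducibility; over O it says that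
OG maps onto the full matrix algebra, so that integral Schur relations follow. *)
Definition spanning : Prop := forall X, exists x, galg_act N x = X.

Definition schur_rel (c : O) : Prop :=
  forall X, gtrace N N X = (c * \tr X)%:M.

(** A trace commutes with the image of OG, hence is scalar; the scalar depends
linearly on X and is unchanged when X is conjugated by the group, so it is a
multiple of the matrix trace.  The constant may be 0; it is a unit exactly when
Higman's criterion can be met. *)
Lemma spanning_schur_rel : (0 < n)%N -> spanning -> exists c, schur_rel c.
Proof.
move=> n_gt0 spN; pose i0 := Ordinal n_gt0.
have cent X Y : gtrace N N X *m Y = Y *m gtrace N N X.
  have [x <-] := spN Y; rewrite /galg_act mulmx_sumr mulmx_suml.
  apply: eq_bigr => g _.
  by rewrite -scalemxAr -scalemxAl -(gtraceP N N X g).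
have scal X := central_scalar_mx i0 (cent X).
pose f X := gtrace N N X i0 i0.
have fD X Y : f (X + Y) = f X + f Y.
  rewrite /f; transitivity ((gtrace N N X + gtrace N N Y) i0 i0); last by rewrite mxE.
  congr (fun_of_matrix _ _ _); rewrite /gtrace -big_split.
  by apply: eq_bigr => g _; rewrite mulmxDr mulmxDl.
have fZ a X : f (a *: X) = a * f X.
  rewrite /f; transitivity ((a *: gtrace N N X) i0 i0); last by rewrite mxE.
  congr (fun_of_matrix _ _ _); rewrite /gtrace scaler_sumr.
  by apply: eq_bigr => g _; rewrite -scalemxAr -scalemxAl.
have f0 : f 0 = 0 by rewrite -(scale0r 0) fZ mul0r.
have fsum (I : finType) (F : I -> 'M[O]_n) : f (\sum_i F i) = \sum_i f (F i).
  by apply: (big_morph f fD f0).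
have fC X Y : f (X *m Y) = f (Y *m X).
  have [x <-] := spN X; rewrite /galg_act mulmx_sumr mulmx_suml !fsum.
  apply: eq_bigr => h _; rewrite -scalemxAr -scalemxAl !fZ; congr (_ * _).
  congr (fun_of_matrix _ _ _); rewrite /gtrace.
  rewrite [RHS](reindex_inj (mulIg h)); apply: eq_bigr => g _ /=.
  rewrite gmodM invMg gmodM !mulmxA; congr (_ *m _).
  by rewrite -[RHS]mulmxA gmodVK mulmx1.
pose c := f (delta_mx i0 i0).
have fE X : f X = c * \tr X.
  rewrite {1}[X]matrix_sum_delta fsum /mxtrace mulr_sumr; apply: eq_bigr => i _.
  rewrite fsum (bigD1 i) //= big1 => [|j ji].
    by rewrite addr0 fZ mulrC -(mul_delta_mx i0 i i) fC mul_delta_mx.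
  by rewrite fZ -(mul_delta_mx i0 i j) fC mul_delta_mx_0 ?f0 ?mulr0 // eq_sym.
by exists c => X; rewrite scal -/(f X) fE.
Qed.

Lemma schur_unit c : (0 < n)%N -> schur_rel c -> higman N -> c \is a GRing.unit.
Proof.
move=> n_gt0 sc [T T1]; pose i0 := Ordinal n_gt0.
have cT : c * \tr T = 1.
  have /matrixP/(_ i0 i0) := sc T.
  by rewrite T1 !mxE eqxx.
by apply/unitrP; exists (\tr T); rewrite mulrC cT; split.
Qed.

Lemma schur_entries c : schur_rel c -> forall i j k l,
  \sum_(g : G) N g i j * N g^-1%g k l = c *+ ((i == l) && (j == k)).
Proof.
move=> sc i j k l; have /matrixP/(_ i l) := sc (delta_mx j k).
have -> : \tr (delta_mx j k : 'M[O]_n) = (j == k)%:R.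
  rewrite /mxtrace (bigD1 j) //= big1 ?addr0 => [|m mj]; first by rewrite mxE eqxx.
  by rewrite mxE (negPf mj).
rewrite /gtrace summxE mxE mulr_natr andbC -mulnb mulrnA => <-.
apply: eq_bigr => g _; rewrite mxE (bigD1 k) //= big1 ?addr0 => [|m mk].
  by rewrite mul_mx_delta eqxx.
by rewrite mul_mx_delta (negPf mk) mul0r.
Qed.

(** Up to the constant of the Schur relations, the inverse of the action of OG
on its block: the Fourier inversion formula. *)
Definition trace_elt X : galg O G := [ffun g => \tr (X *m N g^-1%g)].

Lemma trace_elt_act c X : schur_rel c -> galg_act N (trace_elt X) = c *: X.
Proof.
move=> sc; apply/matrixP=> a b; rewrite /galg_act summxE mxE.
transitivity (\sum_p \sum_q X p q * \sum_(g : G) N g a b * N g^-1%g q p).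
  under [RHS]eq_bigr do under eq_bigr do rewrite mulr_sumr.
  under [RHS]eq_bigr do rewrite exchange_big.
  rewrite exchange_big; apply: eq_bigr => g _ /=.
  rewrite mxE ffunE /mxtrace mulr_suml; apply: eq_bigr => p _.
  rewrite mxE mulr_suml; apply: eq_bigr => q _.
  by rewrite -mulrA (mulrC (N g a b)).
under eq_bigr do under eq_bigr do rewrite (schur_entries sc).
rewrite (bigD1 a) //= [X in _ + X]big1 ?addr0 => [|p pa]; last first.
  by rewrite big1 // => q _; rewrite eq_sym (negPf pa) mulr0.
rewrite (bigD1 b) //= big1 ?addr0 => [|q qb]; first by rewrite !eqxx mulrC.
by rewrite eq_sym (negPf qb) andbF mulr0.
Qed.

Lemma trace_eltD X Y : trace_elt (X + Y) = trace_elt X + trace_elt Y.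
Proof. by apply/ffunP=> g; rewrite !ffunE mulmxDl mxtraceD. Qed.

Lemma trace_eltZ a X : trace_elt (a *: X) = a *: trace_elt X.
Proof. by apply/ffunP=> g; rewrite !ffunE -scalemxAl mxtraceZ. Qed.

Lemma trace_elt0 : trace_elt 0 = 0.
Proof. by rewrite -(scale0r 0) trace_eltZ scale0r. Qed.

(** The map trace_elt is a homomorphism of bimodules for every module, whatever
its Schur constant; simple_block_schur uses it before the constant is known. *)
Lemma trace_elt_mull x X : x * trace_elt X = trace_elt (galg_act N x *m X).
Proof.
apply/ffunP=> g; rewrite !ffunE /galg_act !mulmx_suml raddf_sum /=.
apply: eq_bigr => h _; rewrite ffunE -!scalemxAl mxtraceZ; congr (_ * _).
by rewrite invMg invgK gmodM mulmxA mxtrace_mulC mulmxA.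
Qed.

Lemma trace_elt_mulr x X : trace_elt X * x = trace_elt (X *m galg_act N x).
Proof.
apply/ffunP=> g; rewrite !ffunE /galg_act mulmx_sumr !mulmx_suml raddf_sum /=.
rewrite (reindex_inj (inj_comp (mulgI g) invg_inj)); apply: eq_bigr => h _ /=.
rewrite ffunE -scalemxAr -scalemxAl mxtraceZ mulrC invMg invgK mulgKV.
by rewrite gmodM mulmxA.
Qed.
End Schur.

(** * The block of a module with Schur relations *)

Section SchurBlock.
Local Open Scope classical_set_scope.
Variables (O : idomainType) (G : finGroupType) (n : nat) (N : gmod O G n).
Variable c : O.
Hypotheses (n_gt0 : (0 < n)%N) (c_unit : c \is a GRing.unit)
  (sc : schur_rel N c).
Implicit Types (X Y : 'M[O]_n) (x y : galg O G).

Definition schur_block : set (galg O G) := [set trace_elt N X | X in setT].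

Let e : galg O G := trace_elt N c^-1%:M.

Lemma schur_act X : galg_act N (trace_elt N (c^-1 *: X)) = X.
Proof. by rewrite (trace_elt_act _ sc) scalerA divrr // scale1r. Qed.

Lemma schur_act_id : galg_act N e = 1%:M.
Proof. by rewrite /e -[_%:M]scalemx1 schur_act. Qed.

Lemma schur_id x : schur_block x -> e * x = x /\ x * e = x.
Proof.
move=> [X _ <-].
by rewrite trace_elt_mull trace_elt_mulr schur_act_id mulmx1 mul1mx.
Qed.

Lemma schur_block_inj x : schur_block x -> galg_act N x = 0 -> x = 0.
Proof.
move=> [X _ <-]; rewrite (trace_elt_act _ sc) => cX0.
by rewrite -[X]scale1r -(mulVr c_unit) -scalerA cX0 scaler0 trace_elt0.
Qed.

Lemma schur_block_ideal : ideal_of setT schur_block.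
Proof.
split=> //.
- by exists 0; rewrite ?trace_elt0.
- by move=> _ _ [X _ <-] [Y _ <-]; exists (X + Y); rewrite ?trace_eltD.
- by move=> a _ [X _ <-]; exists (a *: X); rewrite ?trace_eltZ.
by move=> x _ _ [X _ <-]; rewrite trace_elt_mull trace_elt_mulr; split; eexists.
Qed.

Lemma schur_block_dsum :
  algebra_dsum setT schur_block [set x | galg_act N x = 0].
Proof.
split.
- exact: schur_block_ideal.
- split=> //=; first by rewrite galg_act0.
  + by move=> x y x0 y0; rewrite galg_actD x0 y0 addr0.
  + by move=> a x x0; rewrite galg_actZ x0 scaler0.
  by move=> x y _ y0; rewrite !galg_actM y0 mulmx0 mul0mx.
- move=> x _; pose b := trace_elt N (c^-1 *: galg_act N x).
  exists b, (x - b); split; first by eexists.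
    by rewrite /= galg_actD -scaleN1r galg_actZ schur_act scaleN1r subrr.
  by rewrite addrC subrK.
apply/seteqP; split=> [x [Bx /(schur_block_inj Bx)]|x -> /=] //; split.
  by exists 0; rewrite ?trace_elt0.
exact: galg_act0.
Qed.

(** The block is a full matrix algebra over a domain.  In a splitting of it into two
ideals, the component of the identity in the first one is a central idempotent,
hence a scalar idempotent, hence 0 or 1. *)
Lemma schur_block_indecomposable : algebra_indecomposable schur_block.
Proof.
have Be : schur_block e by eexists.
have e0 : e <> 0.
  move=> /(congr1 (galg_act N)); rewrite schur_act_id galg_act0.
  move/matrixP/(_ (Ordinal n_gt0) (Ordinal n_gt0)).
  by rewrite !mxE eqxx => /eqP; rewrite oner_eq0.
split=> [B0|B1 B2 [id1 id2 sum12 int12]].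
  by move: Be; rewrite B0 => /e0.
have [e1 [e2 [B1e1 B2e2 defe]]] := sum12 _ Be.
have [s1 z1 _ _ m1] := id1; have [s2 z2 _ _ m2] := id2.
have int0 x : B1 x -> B2 x -> x = 0.
  by move=> b1 b2; have : (B1 `&` B2) x by []; rewrite int12.
have p12 x y : B1 x -> B2 y -> x * y = 0.
  move=> b1 b2; apply: int0; first by case: (m1 y x (s2 _ b2) b1).
  by case: (m2 x y (s1 _ b1) b2).
have p21 x y : B1 x -> B2 y -> y * x = 0.
  move=> b1 b2; apply: int0; first by case: (m1 y x (s2 _ b2) b1).
  by case: (m2 x y (s1 _ b1) b2).
have [X _ defX] := s1 _ B1e1.
have cX Y : galg_act N e1 *m Y = Y *m galg_act N e1.
  rewrite -(schur_act Y) -!galg_actM; congr galg_act.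
  have [|y1 [y2 [B1y1 B2y2 ->]]] := sum12 (trace_elt N (c^-1 *: Y)).
    by eexists.
  rewrite mulrDl mulrDr (p12 e1 y2) // (p21 e1 y2) // !addr0.
  have [ey ye] := schur_id (s1 _ B1y1).
  have := ey; rewrite defe mulrDl (p21 y1 e2) // addr0 => ->.
  by have := ye; rewrite defe mulrDr (p12 y1 e2) // addr0 => ->.
have [e1e ee1] := schur_id (s1 _ B1e1).
have e1e1 : e1 * e1 = e1.
  by have := e1e; rewrite defe mulrDl (p21 e1 e2) // addr0.
pose i0 := Ordinal n_gt0.
have scal := central_scalar_mx i0 cX.
set a := galg_act N e1 i0 i0 in scal.
have aa : a * (a - 1) = 0.
  rewrite mulrBr mulr1; apply/eqP; rewrite subr_eq0; apply/eqP.
  by rewrite {3}/a -e1e1 galg_actM scal -scalar_mxM mxE eqxx.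
have [a0|a1] : a = 0 \/ a = 1.
  by move/eqP: aa; rewrite mulf_eq0 subr_eq0 => /orP[]/eqP; [left|right].
- left; apply/seteqP; split=> [x B1x|x -> //] /=.
  have [ex _] := schur_id (s1 _ B1x).
  have e10 : e1 = 0.
    by apply: schur_block_inj (s1 _ B1e1) _; rewrite scal a0 raddf0.
  by rewrite -ex defe e10 add0r (p21 x e2).
right; apply/seteqP; split=> [x B2x|x -> //] /=.
have [ex _] := schur_id (s2 _ B2x).
have e20 : e2 = 0.
  apply: schur_block_inj (s2 _ B2e2) _.
  have := congr1 (galg_act N) defe.
  by rewrite galg_actD scal a1 schur_act_id -[LHS]addr0 => /addrI.
by rewrite -ex defe e20 addr0 (p12 e1 x).
Qed.

Lemma schur_block_is_block : is_block schur_block.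
Proof.
split; last exact: schur_block_indecomposable.
by eexists; apply: schur_block_dsum.
Qed.

Lemma schur_block_belongs : belongs_to N schur_block.
Proof.
exists e; split; last exact: schur_act_id; first by eexists.
exact: schur_id.
Qed.

(** If A is an isomorphism of N with its dual, then g |-> g^-1 acts on matrices as
transposition followed by conjugation by A. *)
Lemma schur_block_real : self_dual N -> real_block schur_block.
Proof.
move=> /mod_isoP[A [B [AB BA hA]]].
have inv x : schur_block x -> schur_block (galg_inv x).
  move=> [X _ <-]; exists (B *m X *m A)^T => //.
  apply/ffunP=> g; rewrite !ffunE invgK.
  have -> : N g = A *m (N g^-1%g)^T *m B by rewrite -hA -mulmxA AB mulmx1.
  rewrite -[LHS]mxtrace_tr trmx_mul trmxK [LHS]mxtrace_mulC.
  by rewrite !mulmxA [RHS]mxtrace_mulC !mulmxA.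
apply/seteqP; split=> [x /inv Bx|_ [x /inv Bx <-] //].
exists (galg_inv x) => //; apply/ffunP=> g.
by rewrite !ffunE invgK.
Qed.
End SchurBlock.

(** Matrix units isolate a nonzero entry of X, so the ideal of X is everything. *)
Lemma schur_block_simple (F : fieldType) (G : finGroupType) n (N : gmod F G n)
    c : (0 < n)%N -> c != 0 -> schur_rel N c -> simple_algebra (schur_block N).
Proof.
move=> n_gt0 c0 sc; have cu : c \is a GRing.unit by rewrite unitfE.
split; first by case: (schur_block_indecomposable n_gt0 cu sc).
move=> I [sI I0 ID IZ IM].
have [I_triv|] := pselect (forall x, I x -> x = 0).
  left; apply/seteqP; split=> x; [exact: I_triv | by move=> ->].
move/existsNP=> [x /not_implyP[Ix x0]]; right.
have [X _ defx] := sI _ Ix.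
have [i [j Xij]] : exists i j, X i j != 0.
  apply: contrapT => nX; apply: x0; rewrite -defx.
  suff -> : X = 0 by rewrite trace_elt0.
  apply/matrixP=> i j; rewrite mxE; apply/eqP/negPn/negP=> Xij.
  by apply: nX; exists i, j.
apply/seteqP; split=> [|_ [Y _ <-]]; first exact: sI.
have inI A B : I (trace_elt N (A *m X *m B)).
  have B_in Z : schur_block N (trace_elt N (c^-1 *: Z)) by eexists.
  have [I1 _] := IM _ _ (B_in A) Ix.
  have [_] := IM _ _ (B_in B) I1.
  rewrite -defx (trace_elt_mull N _ X) trace_elt_mulr.
  by rewrite !(schur_act cu sc).
have -> : Y = \sum_a delta_mx a i *m X *m ((X i j)^-1 *: (delta_mx j a *m Y)).
  under eq_bigr => a _ do rewrite -scalemxAr mulmxA.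
  rewrite -scaler_sumr -mulmx_suml.
  suff -> : \sum_(a < n) delta_mx a i *m X *m delta_mx j a = (X i j)%:M.
    by rewrite mul_scalar_mx scalerA mulVf ?scale1r.
  apply/matrixP=> p q; rewrite summxE mxE (bigD1 p) //= big1 ?addr0.
    by rewrite mul_mx_delta mul_delta_mxE eqxx mulr1n eq_sym.
  by move=> a ap; rewrite mul_mx_delta mul_delta_mxE eq_sym (negPf ap) mul0rn.
elim/big_rec: _ => [|a Z _ IZ']; first by rewrite trace_elt0.
by rewrite trace_eltD; apply: ID.
Qed.

(** Every matrix unit lies in the image of the group algebra, so one nonzero entry of
U produces all unit rows. *)
Lemma schur_irreducible (F : fieldType) (G : finGroupType) n (N : gmod F G n)
    c : (0 < n)%N -> c != 0 -> schur_rel N c -> mx_irreducible N.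
Proof.
move=> n_gt0 c0 sc; have cu : c \is a GRing.unit by rewrite unitfE.
apply/mx_irrP; split=> // U /mxmoduleP modU U0.
have [i [j Uij]] : exists i j, U i j != 0.
  apply: contrapT => nX; case/eqP: U0.
  apply/matrixP=> i j; rewrite mxE; apply/eqP/negPn/negP=> Xij.
  by apply: nX; exists i, j.
rewrite -sub1mx; apply/row_subP=> l.
have -> : row l 1%:M = (U i j)^-1 *: (row i U *m delta_mx j l).
  rewrite row1; apply/matrixP=> p q.
  by rewrite [RHS]mxE mul_mx_delta !mxE ord1 eqxx /= mulrnAr mulVf.
apply: scalemx_sub; rewrite -(schur_act cu sc (delta_mx j l)).
rewrite /galg_act mulmx_sumr; apply: summx_sub => g _.
rewrite -scalemxAr; apply: scalemx_sub.
by apply: submx_trans (modU g _); rewrite ?inE // submxMr ?row_sub.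
Qed.

Lemma map_gtrace (O O' : comUnitRingType) (f : {rmorphism O -> O'})
    (G : finGroupType) n m (V : gmod O G n) (W : gmod O G m) X :
  map_mx f (gtrace V W X) = gtrace (map_repr f V) (map_repr f W) (map_mx f X).
Proof.
rewrite /gtrace raddf_sum; apply: eq_bigr => g _.
by rewrite /= !map_mxM.
Qed.

(** Schur relations amount to identities between matrix entries (schur_entries), so
they also hold for matrices over O' that do not come from O. *)
Lemma schur_map (O O' : comUnitRingType) (f : {rmorphism O -> O'})
    (G : finGroupType) n (N : gmod O G n) c :
  schur_rel N c -> schur_rel (map_repr f N) (f c).
Proof.
move=> sc X; apply/matrixP=> i l.
have -> : gtrace (map_repr f N) (map_repr f N) X i l =
    \sum_j \sum_k X j k * f (\sum_(g : G) N g i j * N g^-1%g k l).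
  under [RHS]eq_bigr do under eq_bigr do rewrite rmorph_sum mulr_sumr.
  under [RHS]eq_bigr do rewrite exchange_big.
  rewrite exchange_big /gtrace summxE; apply: eq_bigr => g _ /=.
  rewrite mxE exchange_big; apply: eq_bigr => k _ /=.
  rewrite mxE mulr_suml; apply: eq_bigr => j _.
  by rewrite !mxE rmorphM mulrA (mulrC (X j k)).
under eq_bigr do under eq_bigr do rewrite (schur_entries sc).
rewrite mxE; have [_|_] := eqVneq i l.
  rewrite mulr1n /mxtrace mulr_sumr; apply: eq_bigr => j _.
  rewrite (bigD1 j) //= big1 ?addr0 => [|k kj]; first by rewrite eqxx mulrC.
  by rewrite eq_sym (negPf kj) raddf0 mulr0.
by rewrite big1 // => j _; rewrite big1 // => k _; rewrite raddf0 mulr0.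
Qed.

(** * Involutions and invariant forms in characteristic 2 *)

(** Terms that belong to a two-element orbit occur twice and cancel. *)
Lemma sum_involution (A : nzRingType) (I : finType) (s : I -> I) (F : I -> A) :
  2%N \in [pchar A] -> involutive s -> (forall i, F (s i) = F i) ->
  \sum_i F i = \sum_(i | s i == i) F i.
Proof.
move=> A2 ss Fs; rewrite (bigID (fun i => s i == i)) /= -[RHS]addr0; congr (_ + _).
pose lt i := (enum_rank i < enum_rank (s i))%N.
rewrite (bigID lt) /= [X in _ + X](reindex_inj (inv_inj ss)) /=.
rewrite [X in _ + X](eq_bigl (fun i => (s i != i) && lt i)) => [|i].
  by rewrite [X in _ + X](eq_bigr F) ?addrr_pchar2.
rewrite /lt ss eq_sym; case: eqVneq => //= si.
rewrite -leqNgt leq_eqVlt (inj_eq val_inj) (inj_eq enum_rank_inj).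
by move: si; rewrite eq_sym => /negPf->.
Qed.

Lemma sum_sqr (A : comNzRingType) (I : finType) (P : pred I) (F : I -> A) :
  2%N \in [pchar A] -> \sum_(i | P i) F i ^+ 2 = (\sum_(i | P i) F i) ^+ 2.
Proof.
move=> A2; rewrite (big_morph (fun x => x ^+ 2) (op1 := +%R) (id1 := 0)) //.
  by move=> x y; rewrite sqrrD mulr2n addrr_pchar2 // addr0.
by rewrite expr0n.
Qed.

Lemma mxtrace11M (A : comPzRingType) (a b : 'M[A]_1) :
  \tr (a *m b) = \tr a * \tr b.
Proof. by rewrite !trace_mx11 mxE big_ord1. Qed.

Section Fixed.
Variables (O : comUnitRingType) (G : finGroupType).

Definition fixed_by (C : {set G}) n (P : gmod O G n) (u : 'cV[O]_n) : Prop :=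
  {in C, forall h, P h *m u = u}.

(** A fixed vector of a projective module is a trace over the fixing subgroup:
split the sum over G in Higman's criterion along right cosets of C. *)
Lemma fixed_trace (C : {group G}) n (P : gmod O G n) u :
  higman P -> fixed_by C P u -> exists y, u = \sum_(h in C) P h *m y.
Proof.
move=> [T T1] fixu; pose rep g := repr (C :* g)%g.
pose X := [set x | rep x == x]%SET.
exists (\sum_(x in X) P x *m T *m P x^-1%g *m u).
rewrite -{1}[u]mul1mx -T1 /gtrace mulmx_suml.
have repC g h : h \in C -> rep (h * g)%g = rep g.
  move=> Ch; rewrite /rep; congr (repr _); apply/rcoset_eqP.
  by rewrite mem_rcoset mulgK.
have repP g : exists2 h, h \in C & rep g = (h * g)%g.
  by have /rcosetP := mem_repr_rcoset C g.
(* X is the transversal of the representatives of the right cosets of C. *)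
rewrite (partition_big rep (mem X)) => [|g _] /=; last first.
  by rewrite inE; have [h Ch def] := repP g; rewrite {1}def repC.
under [RHS]eq_bigr do rewrite mulmx_sumr.
rewrite [RHS]exchange_big /=; apply: eq_bigr => x; rewrite inE => /eqP repx.
have repE h : rep (h * x)%g = x -> h \in C.
  have [l Cl] := repP (h * x)%g; move=> ->; rewrite mulgA.
  move/(canRL (mulgK x)); rewrite mulgV => /eqP.
  by rewrite -eq_invg_mul => /eqP <-; rewrite groupV.
rewrite (reindex_inj (mulIg x)) /=; apply: eq_big => [h|h].
  by apply/eqP/idP => [/repE|Ch]; last by rewrite repC.
move=> /eqP/repE Ch.
by rewrite gmodM invMg gmodM !mulmxA -[in LHS]mulmxA fixu ?groupV.
Qed.
End Fixed.

Section FixedForms.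
Variables (k : fieldType) (G : finGroupType).
Hypothesis k2 : 2%N \in [pchar k].

Lemma dualE n (P : gmod k G n) g : dual P g = (P g^-1%g)^T.
Proof. by []. Qed.

Section Form.
Variables (n : nat) (P : gmod k G n) (v : 'rV[k]_n) (y : 'cV[k]_n) (t z : G).

Let F g : k := \tr (v *m P (t * g)%g *m y) * \tr (v *m P (g * z)%g *m y).

(** The invariant form built from y, evaluated at v P(t) and v. *)
Lemma form_expand :
  \tr (v *m P t *m gtrace P (dual P) (y *m (P z *m y)^T) *m v^T) = \sum_(g : G) F g.
Proof.
rewrite /gtrace mulmx_sumr mulmx_suml raddf_sum; apply: eq_bigr => g _ /=.
rewrite /dual_mx invgK -[X in _ = _ * X]mxtrace_tr -mxtrace11M !gmodM.
by rewrite !trmx_mul !mulmxA.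
Qed.

Hypotheses (t2 : (t * t)%g = 1%g) (z2 : (z * z)%g = 1%g).

(** The involution g |-> tgz exchanges the two factors of F. *)
Lemma form_fixed : \sum_(g : G) F g = \sum_(g | z == (t ^ g)%g) F g.
Proof.
rewrite (@sum_involution _ _ (fun g => (t * g * z)%g)) //.
- apply: eq_bigl => g; rewrite conjgE.
  rewrite -(inj_eq (mulgI (t * g)^-1%g)) mulKg.
  by rewrite invMg -[t^-1%g]mulg1 -{1}t2 mulKg -mulgA.
- by move=> g; rewrite -!mulgA z2 mulg1 mulgA t2 mul1g.
by move=> g /=; rewrite /F mulrC -!mulgA z2 mulg1 [(t * (t * _))%g]mulgA t2 mul1g.
Qed.

End Form.

(** For z = t the fixed points of the involution are the elements of C(t), on which
the two factors agree; in characteristic 2 a sum of squares is a square. *)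
Lemma form_square n (P : gmod k G n) t (y : 'cV_n) (v : 'rV_n) : (t * t)%g = 1%g ->
  \tr (v *m P t *m gtrace P (dual P) (y *m (P t *m y)^T) *m v^T) =
  (\tr (v *m (\sum_(h in 'C[t]) P h *m y))) ^+ 2.
Proof.
move=> t2; rewrite form_expand form_fixed //.
have Ct : t \in 'C[t] by rewrite cent1id.
rewrite [in RHS](reindex_inj (mulIg t)) /=.
rewrite mulmx_sumr raddf_sum -sum_sqr //; apply: eq_big => g.
  by rewrite groupMr // -cent1C cent1E conjgE eq_sym -(inj_eq (mulgI g)) mulKVg.
rewrite conjgE -(inj_eq (mulgI g)) mulKVg => /eqP <-.
by rewrite /= mulmxA expr2.
Qed.

Lemma form_conj n (P : gmod k G n) t z (y : 'cV_n) (v : 'rV_n) :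
  (t * t)%g = 1%g -> (z * z)%g = 1%g -> (forall g, z != (t ^ g)%g) ->
  \tr (v *m P t *m gtrace P (dual P) (y *m (P z *m y)^T) *m v^T) = 0.
Proof.
by move=> t2 z2 tz; rewrite form_expand form_fixed // big1 // => g; rewrite (negPf (tz g)).
Qed.

(** The square of v A u is the value at v A of a trace form on P; the restriction
of that form to N is again a trace form.  So it cannot vanish if u does not
vanish on N. *)
Lemma submodule_form n m (P : gmod k G n) (N : gmod k G m) A t
    (u : 'cV_n) :
  (t * t)%g = 1%g -> higman P -> intertwines N P A -> fixed_by 'C[t] P u ->
  A *m u != 0 -> exists Y, gtrace N (dual N) Y != 0.
Proof.
move=> t2 hP hA fixu Au; have [y def_u] := fixed_trace hP fixu.
set S := gtrace P (dual P) (y *m (P t *m y)^T).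
exists (A *m (y *m (P t *m y)^T) *m A^T).
have hAT : intertwines (dual P) (dual N) A^T.
  by move=> g; rewrite !dualE -!trmx_mul hA.
rewrite -(gtrace_mulr _ _ hAT) -(gtrace_mull _ _ hA) -/S.
apply: contraNneq Au => S0; apply/eqP/matrixP=> i j; rewrite [RHS]mxE ord1.
pose v : 'rV_n := delta_mx 0 i *m A.
have : \tr (v *m P t *m S *m v^T) = 0.
  rewrite /v -[_ *m A *m _]mulmxA -hA trmx_mul.
  rewrite -!mulmxA (mulmxA A) (mulmxA (A *m _)) S0.
  by rewrite mul0mx !mulmx0 raddf0.
rewrite /S form_square // -def_u => /eqP; rewrite sqrf_eq0 => /eqP.
by rewrite /v trace_mx11 -mulmxA mul_delta_mxE eqxx.
Qed.
End FixedForms.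

(** * Irreducible modules with a projective form *)

Section Irreducible.
Variables (k : closedFieldType) (G : finGroupType) (n : nat) (N : gmod k G n).
Hypothesis irrN : mx_irreducible N.

Lemma irr_gt0 : (0 < n)%N.
Proof. by have [/(_ irrN)[]] := mx_irrP N. Qed.

Lemma irr_spanning : spanning N.
Proof.
move=> X; have absN := group_closure_closed_field irrN.
have /envelop_mxP[a ->] : (X \in enveloping_algebra_mx N)%MS.
  by case/andP: absN => _ /eqP full; apply: submx_full; rewrite /row_full full.
exists [ffun g => a g]; apply: eq_big => [g|g _]; first by rewrite inE.
by rewrite ffunE.
Qed.

(** The kernel of a homomorphism is a submodule. *)
Lemma irr_intertwines m (W : gmod k G m) A :
  intertwines N W A -> A != 0 -> row_free A.
Proof.
move=> hA A0; rewrite -kermx_eq0; apply: contraT => ker0.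
have [/(_ irrN)[_ full] _] := mx_irrP N.
have : row_full (kermx A).
  apply: full => //; apply/mxmoduleP=> g _; apply/sub_kermxP.
  by rewrite -mulmxA hA mulmxA mulmx_ker mul0mx.
rewrite -sub1mx => /sub_kermxP; rewrite mul1mx => A00.
by rewrite A00 eqxx in A0.
Qed.

(** A nonzero invariant bilinear form on N that is a trace from the trivial
subgroup, that is, a map from N to its dual that factors through a projective
module.  For irreducible N it says that N is both self-dual and projective. *)
Definition has_projective_form : Prop := exists Y, gtrace N (dual N) Y != 0.

Lemma projective_formP : has_projective_form ->
  exists Y S, [/\ S = gtrace N (dual N) Y, intertwines N (dual N) S &
    S \in unitmx].
Proof.
move=> [Y S0]; exists Y, (gtrace N (dual N) Y).
split=> //; first exact: gtraceP.
by rewrite -row_free_unit; apply: irr_intertwines S0; apply: gtraceP.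
Qed.

Hypothesis formN : has_projective_form.

(** Composing the trace form with its inverse exhibits the identity as a trace. *)
Lemma form_higman : higman N.
Proof.
have [Y [S [defS hS Su]]] := projective_formP formN.
have hV := intertwines_inv (mulmxV Su) (mulVmx Su) hS.
by exists (Y *m invmx S); rewrite -(gtrace_mulr N Y hV) -defS mulmxV.
Qed.

Lemma form_schur : exists2 c, c != 0 & schur_rel N c.
Proof.
have [c sc] := spanning_schur_rel irr_gt0 irr_spanning.
by exists c => //; rewrite -unitfE; apply: schur_unit irr_gt0 sc form_higman.
Qed.

Hypothesis k2 : 2%N \in [pchar k].

Lemma eq_sqr_pchar2 (a b : k) : a ^+ 2 = b ^+ 2 -> a = b.
Proof.
move=> ab; apply/eqP; rewrite -subr_eq0 -sqrf_eq0 sqrrB mulr2n addrr_pchar2 //.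
by rewrite subr0 ab addrr_pchar2.
Qed.

(** By Schur's lemma the transpose of S is a scalar multiple of S; the scalar has
square 1, and 1 is the only such scalar in characteristic 2. *)
Lemma projective_form_sym S :
  intertwines N (dual N) S -> S \in unitmx -> S^T = S.
Proof.
move=> hS Su.
have hST : intertwines N (dual N) S^T.
  move=> g; apply: trmx_inj; rewrite dualE !trmx_mul !trmxK.
  by have := hS g^-1%g; rewrite dualE invgK.
have hV := intertwines_inv (mulmxV Su) (mulVmx Su) hS.
have hZ := intertwines_mul hST hV.
have cZ Y : S^T *m invmx S *m Y = Y *m (S^T *m invmx S).
  have [x <-] := irr_spanning Y; rewrite /galg_act mulmx_sumr mulmx_suml.
  by apply: eq_bigr => g _; rewrite -scalemxAr -scalemxAl hZ.
pose i0 := Ordinal irr_gt0.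
have scal := central_scalar_mx i0 cZ; set a := (_ i0 i0) in scal.
have STE : S^T = a *: S.
  by rewrite -mul_scalar_mx -scal mulmxKV.
have SE : S = (a ^+ 2) *: S.
  by rewrite -{1}[S]trmxK STE linearZ /= STE scalerA.
have a2 : a ^+ 2 = 1 ^+ 2.
  have /(congr1 (mulmx (invmx S))) := SE; rewrite -scalemxAr mulVmx //.
  move/matrixP/(_ i0 i0); rewrite !mxE eqxx mulr1 expr1n.
  by move/esym.
by rewrite STE (eq_sqr_pchar2 a2) scale1r.
Qed.

Section Orthogonality.
Variables (S : 'M[k]_n) (c : k).
Hypotheses (hS : intertwines N (dual N) S) (Su : S \in unitmx).
Hypotheses (c0 : c != 0) (sc : schur_rel N c).

Let q t (v : 'rV[k]_n) := \tr (v *m N t *m S *m v^T).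
Let q' t (y : 'cV[k]_n) := \tr (y *m (N t *m y)^T *m invmx S).

(** The form built from y is a multiple of S, with a factor that the Schur relations
compute.  The two values q' and q of fixed bilinear expressions separate the
dependence on y from the dependence on v. *)
Lemma form_schurE t z y (v : 'rV_n) :
  \tr (v *m N t *m gtrace N (dual N) (y *m (N z *m y)^T) *m v^T) =
  c * q' z y * q t v.
Proof.
have hV := intertwines_inv (mulmxV Su) (mulVmx Su) hS.
set S' := gtrace _ _ _.
have -> : S' = (c * q' z y) *: S.
  rewrite -mul_scalar_mx -[_%:M]sc -(gtrace_mulr _ _ hV) -mulmxA mulVmx //.
  by rewrite mulmx1.
by rewrite -scalemxAr -scalemxAl mxtraceZ.
Qed.

(** N(t)S is symmetric when t has square 1, and the claim is that for some t it is not
alternating.  The sum of F over G is the Schur constant, while F takes equal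
values at g and g^-1, so some g equal to its inverse contributes. *)
Lemma form_involution : exists2 t : G, (t * t)%g = 1%g & exists v, q t v != 0.
Proof.
pose i0 := Ordinal irr_gt0; pose v : 'rV[k]_n := delta_mx 0 i0.
have vv : \tr (v *m v^T) = 1.
  by rewrite /v trmx_delta mul_delta_mx trace_mx11 mxE eqxx.
have ST := projective_form_sym hS Su.
have ST' : (invmx S)^T = invmx S by rewrite trmx_inv ST.
pose F g := q g v * \tr (v *m invmx S *m N g^-1%g *m v^T).
have Fsum : \sum_g F g = c.
  have := congr1 (fun X => \tr (v *m X *m v^T)) (sc (S *m v^T *m v *m invmx S)).
  have -> : \tr (S *m v^T *m v *m invmx S) = 1.
    by rewrite mxtrace_mulC !mulmxA mulVmx // mul1mx mxtrace_mulC.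
  rewrite mul_mx_scalar -scalemxAl mxtraceZ vv !mulr1 => <-.
  rewrite /gtrace mulmx_sumr mulmx_suml raddf_sum; apply: eq_bigr => g _ /=.
  by rewrite /F /q -mxtrace11M !mulmxA.
have FV g : F g^-1%g = F g.
  rewrite /F /q invgK -[X in X * _]mxtrace_tr -[X in _ * X]mxtrace_tr.
  rewrite !trmx_mul !trmxK ST ST' !mulmxA.
  have E h : S *m (N h^-1%g)^T = N h *m S by rewrite hS.
  congr (_ * _).
    by rewrite -(mulmxA v S) E !mulmxA.
  rewrite -(mulmxA v _ (invmx S)); suff -> : (N g)^T *m invmx S = invmx S *m N g^-1%g by rewrite mulmxA.
  apply: (canRL (mulKmx Su)); rewrite mulmxA -{1}[g]invgK E -mulmxA.
  by rewrite mulmxV ?mulmx1.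
have : \sum_(g : G | g^-1%g == g) F g != 0.
  by rewrite -(sum_involution k2 (@invgK G) FV) Fsum.
apply: contraNP => nt; rewrite big1 // => t /eqP tV.
apply/eqP; rewrite mulf_eq0; apply/orP; left; apply: contraT => qt.
by case: nt; exists t; [rewrite -{1}tV mulVg | exists v].
Qed.

(** With y = S v^T the factors q' and q of form_schurE coincide, so the trace of y
over C(t) is a nonzero fixed vector as soon as v N(t) S v^T is nonzero. *)
Lemma form_fixed_exists :
  exists t (u : 'cV_n), [/\ (t * t)%g = 1%g, u != 0 & fixed_by 'C[t] N u].
Proof.
have [t t2 [v qtv]] := form_involution.
pose u := \sum_(h in 'C[t]%G) N h *m (S *m v^T).
exists t, u; split=> //.
  have := form_square k2 N (S *m v^T) v t2; rewrite form_schurE.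
  have -> : q' t (S *m v^T) = q t v.
    rewrite /q' mxtrace_mulC !mulmxA mulVmx // mul1mx mxtrace_mulC.
    by rewrite -mxtrace_tr trmx_mul !trmxK !mulmxA.
  rewrite -/u => E; apply: contraNneq qtv => u0.
  move/eqP: E; rewrite u0 mulmx0 raddf0 expr0n !mulf_eq0 (negPf c0) /=.
  by rewrite orbb.
move=> h Ch; rewrite /u mulmx_sumr [RHS](reindex_inj (mulgI h)).
apply: eq_big => [g|g _]; first by rewrite groupMl.
by rewrite mulmxA gmodM.
Qed.

(** The squares of v u and v u' are proportional functions of v, so u and u' are
proportional. *)
Lemma form_fixed_unique t (u u' : 'cV_n) : (t * t)%g = 1%g ->
  fixed_by 'C[t] N u -> fixed_by 'C[t] N u' -> u != 0 ->
  exists a, u' = a *: u.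
Proof.
move=> t2 fu fu' u0.
have [y def_u] := fixed_trace (C := 'C[t]%G) form_higman fu.
have [y' def_u'] := fixed_trace (C := 'C[t]%G) form_higman fu'.
have E v : \tr (v *m u) ^+ 2 = c * q' t y * q t v.
  by rewrite def_u -form_square // form_schurE.
have E' v : \tr (v *m u') ^+ 2 = c * q' t y' * q t v.
  by rewrite def_u' -form_square // form_schurE.
have [i ui] : exists i, u i 0 != 0.
  apply: contrapT => nX; case/eqP: u0.
  apply/matrixP=> i j; rewrite mxE ord1; apply/eqP/negPn/negP=> Xij.
  by apply: nX; exists i.
have ev (w : 'cV[k]_n) j : \tr (delta_mx 0 j *m w) = w j 0.
  by rewrite trace_mx11 mul_delta_mxE eqxx.
exists (u' i 0 / u i 0); apply/matrixP=> j l; rewrite ord1 mxE.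
apply: (mulIf ui); rewrite mulrAC divfK //; apply: eq_sqr_pchar2.
rewrite !exprMn -!ev !E !E' /=.
by rewrite mulrACA [RHS]mulrACA; congr (_ * _); apply: mulrC.
Qed.

(** For t and z that are not conjugate the product of q' at z and q at t vanishes for
all y and v, whereas a nonzero vector fixed by C(t) makes q at t nonzero and one
fixed by C(z) makes q' at z nonzero. *)
Lemma form_fixed_conj t z (u u' : 'cV_n) :
  (t * t)%g = 1%g -> (z * z)%g = 1%g ->
  fixed_by 'C[t] N u -> fixed_by 'C[z] N u' -> u != 0 -> u' != 0 ->
  exists g, z = (t ^ g)%g.
Proof.
move=> t2 z2 fu fu' u0 u0'.
have [y def_u] := fixed_trace (C := 'C[t]%G) form_higman fu.
have [y' def_u'] := fixed_trace (C := 'C[z]%G) form_higman fu'.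
have ex (w : 'cV[k]_n) : w != 0 -> exists v : 'rV_n, \tr (v *m w) != 0.
  move=> w0; apply: contrapT => nX; case/eqP: w0.
  apply/matrixP=> i j; rewrite [RHS]mxE ord1; apply/eqP/negPn/negP=> Xij.
  by apply: nX; exists (delta_mx 0 i); rewrite trace_mx11 mul_delta_mxE eqxx.
have [v vu] := ex _ u0; have [v' vu'] := ex _ u0'.
have qtv : q t v != 0.
  have := form_square k2 N y v t2; rewrite -def_u form_schurE => E.
  apply: contraNneq vu => q0.
  by move/esym/eqP: E; rewrite q0 mulr0 sqrf_eq0.
have qzy : q' z y' != 0.
  have := form_square k2 N y' v' z2; rewrite -def_u' form_schurE => E.
  apply: contraNneq vu' => q0.
  by move/esym/eqP: E; rewrite q0 mulr0 mul0r sqrf_eq0.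
apply: contrapT => nconj.
have zt g : z != (t ^ g)%g by apply/eqP=> E; apply: nconj; exists g.
have /eqP := form_conj k2 N y' v t2 z2 zt.
by rewrite form_schurE !mulf_eq0 (negPf c0) (negPf qtv) (negPf qzy).
Qed.
End Orthogonality.
End Irreducible.

(** * Induced modules and reduction of coefficients *)

Section Induced.
Variables (O : comUnitRingType) (G : finGroupType) (H : {group G}).
Variables (n : nat) (P : gmod O G n).
Let Ind := induced (trivial_mod O H).

(** Frobenius reciprocity: the columns of a homomorphism into the induced module are
translates of one vector fixed by H. *)
Lemma induced_col a : intertwines P Ind a ->
  forall g i j, (coset_rep i * g * (coset_rep j)^-1)%g \in H ->
  P g *m submxrow a j = submxrow a i.
Proof.
move=> ha g i j Hg; rewrite mul_submxrow ha -{1}[a]submxrowK.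
rewrite /= /ind_mx mul_mxrow_mxblock mxrowK (bigD1 i) //= Hg mulmx1.
rewrite big1 ?addr0 // => l li; case: ifP => [Hl|]; last by rewrite mulmx0.
case/eqP: li; apply/eqP; rewrite -coset_repV.
have := groupM Hl (groupVr Hg).
by rewrite !invMg !invgK -!mulgA mulKg mulKVg.
Qed.

Lemma induced_hom u : fixed_by H P u ->
  exists2 a, intertwines P Ind a &
    forall i, submxrow a i = P (coset_rep i)^-1%g *m u.
Proof.
move=> fu.
pose a := \mxrow_(i < #|rcosets H [set: G]|) (P (coset_rep i)^-1%g *m u).
exists a => [g|i]; last by rewrite mxrowK.
rewrite mul_mxrow /= /ind_mx mul_mxrow_mxblock; apply: eq_mxrow => j.
have [l] := coset_rep_ex H (coset_rep j * g^-1)%g.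
rewrite -groupV !invMg !invgK mulgA => Hl.
rewrite (bigD1 l) //= Hl mulmx1 big1 ?addr0 => [|i il].
  rewrite -[in RHS](fu _ Hl) !mulmxA -!gmodM; congr (P _ *m u).
  by rewrite !mulgA mulVg mul1g.
case: ifP => [Hi|]; last by rewrite mulmx0.
case/eqP: il; apply/eqP; rewrite -coset_repV.
have := groupM Hi (groupVr Hl).
by rewrite !invMg !invgK -!mulgA mulKg mulKVg.
Qed.
End Induced.

(** What the argument needs from the coefficient ring: it is local with residue field
k, and idempotent matrices over k lift, in such a way that whatever commutes with
the approximate idempotent commutes with the lift.  The last clause makes the
lift of an endomorphism of a module an endomorphism again. *)
Record idempotent_lifting (O : idomainType) (k : fieldType)
    (red : {rmorphism O -> k}) : Prop := IdempotentLifting {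
  residue_surj : forall a, exists x, red x = a;
  residue_unit : forall x, red x != 0 -> x \is a GRing.unit;
  residue_idem : forall n (X : 'M[O]_n),
    map_mx red (X *m X) = map_mx red X ->
    exists E, [/\ E *m E = E, map_mx red E = map_mx red X &
                  forall Y, Y *m X = X *m Y -> Y *m E = E *m Y]
}.

Lemma iso_dadd (O : comUnitRingType) (G : finGroupType) n q q' (P : gmod O G n)
    (U : gmod O G q) (U' : gmod O G q') a b a' b' :
  intertwines P U b -> intertwines P U' b' ->
  a *m b = 1%:M -> a' *m b' = 1%:M -> b *m a + b' *m a' = 1%:M ->
  mod_iso P (dadd U U').
Proof.
move=> hb hb' ab ab' sum1.
have orth m1 m2 (c : 'M[O]_(m1, n)) (d : 'M_(n, m1)) (c' : 'M[O]_(m2, n))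
    (d' : 'M_(n, m2)) : c *m d = 1%:M -> c' *m d' = 1%:M ->
    d *m c + d' *m c' = 1%:M -> c *m d' = 0.
  move=> cd cd' s1; have := congr1 (mulmx c) s1.
  rewrite mulmxDr mulmxA cd mul1mx mulmx1 => /(canRL (addKr _)).
  rewrite addNr => /(congr1 (mulmx^~ d')).
  by rewrite mul0mx -!mulmxA cd' mulmx1.
apply/mod_isoP; exists (row_mx b b'), (col_mx a a'); split.
- by rewrite mul_row_col.
- rewrite mul_col_row ab ab' (orth _ _ a b a' b') //.
  by rewrite (orth _ _ a' b' a b) // 1?addrC // -scalar_mx_block.
move=> g; rewrite mul_mx_row hb hb' /= /dadd_mx mul_row_block.
by rewrite !mulmx0 addr0 add0r.
Qed.

Section Lifting.
Variables (O : idomainType) (k : fieldType) (red : {rmorphism O -> k}).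
Hypothesis lift : idempotent_lifting red.

Lemma lift_mx m n (X : 'M[k]_(m, n)) : exists Y, map_mx red Y = X.
Proof.
have [f fK] := choice (residue_surj lift).
by exists (map_mx f X); apply/matrixP=> i j; rewrite !mxE fK.
Qed.

Lemma lift_unitmx n (U : 'M[O]_n) : map_mx red U \in unitmx -> U \in unitmx.
Proof.
by rewrite !unitmxE det_map_mx unitfE; apply: (residue_unit lift).
Qed.

(** 1 - Z is invertible because its reduction is, and Z(1 - Z) = 0. *)
Lemma idempotent_red0 n (Z : 'M[O]_n) : Z *m Z = Z -> map_mx red Z = 0 -> Z = 0.
Proof.
move=> ZZ Z0; have u1 : 1%:M - Z \in unitmx.
  by apply: lift_unitmx; rewrite map_mxB Z0 subr0 map_scalar_mx rmorph1 unitmx1.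
by rewrite -[Z](mulmxK u1) mulmxBr mulmx1 ZZ subrr mul0mx.
Qed.

(** Direct summands of free modules over a local ring are free: lift a basis of the
image and of the coimage of the reduction of E and project them by E; this gives
an idempotent E' below E with the same reduction, so E - E' is 0. *)
Lemma idempotent_factor n (E : 'M[O]_n) : E *m E = E ->
  exists q (C : 'M[O]_(q, n)) D, C *m D = 1%:M /\ D *m C = E.
Proof.
move=> EE; pose e := map_mx red E.
have ee : e *m e = e by rewrite -map_mxM EE.
have [r [rb [cb [fr fc cr]]]] : exists r (rb : 'M_(r, n)) cb,
    [/\ row_free rb, row_full cb & cb *m rb = e].
  exists (\rank e), (row_base e), (col_base e).
  by rewrite row_base_free col_base_full mulmx_base.
have [C0 C0E] := lift_mx rb; have [D0 D0E] := lift_mx cb.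
have bb : rb *m cb = 1%:M.
  apply: (row_full_inj fc); apply: (row_free_inj fr).
  by rewrite mulmx1 mulmxA cr -mulmxA cr ee.
pose C := C0 *m E; pose D := E *m D0.
have CE : C *m E = C by rewrite -mulmxA EE.
have ED : E *m D = D by rewrite mulmxA EE.
have rC : map_mx red C = rb *m e by rewrite map_mxM C0E.
have rD : map_mx red D = e *m cb by rewrite map_mxM D0E.
clearbody C D.
have redCD : map_mx red (C *m D) = 1%:M.
  by rewrite map_mxM rC rD -mulmxA (mulmxA e) ee -cr !mulmxA bb mul1mx.
have uCD : C *m D \in unitmx by apply: lift_unitmx; rewrite redCD unitmx1.
exists _, (invmx (C *m D) *m C), D; split; first by rewrite -mulmxA mulVmx.
pose E' := D *m (invmx (C *m D) *m C).
have E'E' : E' *m E' = E'.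
  by rewrite /E' !mulmxA -(mulmxA _ C D) mulmxKV.
have EE' : E *m E' = E' by rewrite /E' mulmxA ED.
have E'E : E' *m E = E' by rewrite /E' -!mulmxA CE.
apply/esym/eqP; rewrite -subr_eq0 -/E'; apply/eqP/idempotent_red0.
  by rewrite mulmxBl !mulmxBr EE EE' E'E E'E' subrr subr0.
have rI : map_mx red (invmx (C *m D)) = 1%:M.
  rewrite -[LHS]mulmx1 -redCD -map_mxM mulVmx //.
  by rewrite map_scalar_mx rmorph1.
rewrite map_mxB -/e /E' !map_mxM rI mul1mx rC rD.
by rewrite -mulmxA (mulmxA cb) cr !ee subrr.
Qed.

Variable G : finGroupType.

Lemma idempotent_image n (P : gmod O G n) E :
  intertwines P P E -> E *m E = E ->
  exists q (U : gmod O G q) C D,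
    [/\ intertwines U P C, intertwines P U D, C *m D = 1%:M & D *m C = E].
Proof.
move=> hE EE; have [q [C [D [CD DC]]]] := idempotent_factor EE.
have rU : mx_repr [set: G]%G (fun g => C *m P g *m D).
  split=> [|g h _ _]; first by rewrite repr_mx1 mulmx1.
  rewrite !mulmxA -(mulmxA _ D C) DC -(mulmxA C (P g)) hE -DC.
  by rewrite !mulmxA CD mul1mx gmodM !mulmxA.
exists q, (MxRepresentation rU), C, D; split=> // g /=.
  by rewrite -!mulmxA DC hE -DC !mulmxA CD mul1mx.
by rewrite !mulmxA DC -hE -DC -!mulmxA CD mulmx1.
Qed.

(** It is enough that the composite be invertible, which can be tested on the
reduction. *)
Lemma retract_summand n m (N : gmod O G n) (P : gmod O G m) a b :
  intertwines N P a -> intertwines P N b -> a *m b \in unitmx ->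
  direct_summand N P.
Proof.
move=> ha hb uab; pose b' := b *m invmx (a *m b).
have hab := intertwines_mul ha hb.
have hb' : intertwines P N b'.
  apply: intertwines_mul hb _.
  exact: intertwines_inv (mulmxV uab) (mulVmx uab) hab.
have ab' : a *m b' = 1%:M by rewrite mulmxA mulmxV.
clearbody b'.
have hE := intertwines_mul hb' ha.
have hF : intertwines P P (1%:M - b' *m a).
  by move=> g; rewrite mulmxBl mulmxBr mulmx1 mul1mx hE.
have FF : (1%:M - b' *m a) *m (1%:M - b' *m a) = 1%:M - b' *m a.
  rewrite mulmxBl !mulmxBr !mulmx1 !mul1mx mulmxA -(mulmxA b') ab' mulmx1.
  by rewrite subrr subr0.
have [q [W [C [D [hC hD CD DC]]]]] := idempotent_image hF FF.
by exists q, W; apply: (iso_dadd hb' hD ab' CD); rewrite DC addrC subrK.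
Qed.

Lemma indecomposable_idempotent n (P : gmod O G n) E :
  indecomposable P -> intertwines P P E -> E *m E = E -> E = 0 \/ E = 1%:M.
Proof.
move=> [_ indP] hE EE.
have hF : intertwines P P (1%:M - E).
  by move=> g; rewrite mulmxBl mulmxBr mulmx1 mul1mx hE.
have FF : (1%:M - E) *m (1%:M - E) = 1%:M - E.
  by rewrite mulmxBl !mulmxBr !mulmx1 !mul1mx EE subrr subr0.
have [q [U [C [D [hC hD CD DC]]]]] := idempotent_image hE EE.
have [q' [U' [C' [D' [hC' hD' CD' DC']]]]] := idempotent_image hF FF.
have iso : mod_iso P (dadd U U').
  by apply: (iso_dadd hD hD' CD CD'); rewrite DC DC' addrC subrK.
have dim0 p m1 m2 (X : 'M[O]_(m1, p)) (Y : 'M[O]_(p, m2)) : p = 0%N -> X *m Y = 0.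
  by move=> p0; move: X Y; rewrite p0 => X Y; rewrite thinmx0 mul0mx.
have [q0|q0] := indP _ _ _ _ iso; first by left; rewrite -DC dim0.
by right; apply/esym/eqP; rewrite -subr_eq0 -DC' dim0.
Qed.

Lemma retract_indecomposable n m (N : gmod O G n) (P : gmod O G m) a b :
  (0 < n)%N -> indecomposable P ->
  intertwines N P a -> intertwines P N b -> a *m b \in unitmx -> mod_iso P N.
Proof.
move=> n_gt0 indP ha hb uab; pose b' := b *m invmx (a *m b).
have hab := intertwines_mul ha hb.
have hb' : intertwines P N b'.
  apply: intertwines_mul hb _.
  exact: intertwines_inv (mulmxV uab) (mulVmx uab) hab.
have ab' : a *m b' = 1%:M by rewrite mulmxA mulmxV.
clearbody b'.
have hE := intertwines_mul hb' ha.
have EE : (b' *m a) *m (b' *m a) = b' *m a.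
  by rewrite mulmxA -(mulmxA b') ab' mulmx1.
apply/mod_isoP; exists b', a; split=> //.
have [E0|//] := indecomposable_idempotent indP hE EE.
have : a *m b' *m (a *m b') = 0 by rewrite mulmxA -(mulmxA a) E0 mulmx0 mul0mx.
rewrite ab' mulmx1 => /matrixP/(_ (Ordinal n_gt0) (Ordinal n_gt0)).
by rewrite !mxE eqxx => /eqP; rewrite oner_eq0.
Qed.

(** A homomorphism from a projective module is the trace of a linear map, and linear
maps lift. *)
Lemma hom_lift_source n m (V : gmod O G n) (W : gmod O G m) A : higman V ->
  intertwines (map_repr red V) (map_repr red W) A ->
  exists2 B, intertwines V W B & map_mx red B = A.
Proof.
move=> [T T1] hA; have [A' A'E] := lift_mx A.
exists (gtrace V W (T *m A')); first exact: gtraceP.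
rewrite map_gtrace map_mxM A'E -(gtrace_mulr _ _ hA) -map_gtrace T1.
by rewrite map_scalar_mx rmorph1 mul1mx.
Qed.

Lemma higman_map n (V : gmod O G n) : higman V -> higman (map_repr red V).
Proof.
move=> [T T1]; exists (map_mx red T).
by rewrite -map_gtrace T1 map_scalar_mx rmorph1.
Qed.

Lemma intertwines_map n m (V : gmod O G n) (W : gmod O G m) A :
  intertwines V W A ->
  intertwines (map_repr red V) (map_repr red W) (map_mx red A).
Proof. by move=> hA g; rewrite /= -!map_mxM hA. Qed.

(** Lift E first to an endomorphism, then to an idempotent endomorphism.  So the
reduction of an indecomposable projective module is indecomposable. *)
Lemma indecomposable_red_idempotent n (P : gmod O G n) E :
  indecomposable P -> higman P ->
  intertwines (map_repr red P) (map_repr red P) E -> E *m E = E ->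
  E = 0 \/ E = 1%:M.
Proof.
move=> indP hP hE EE; have [X hX XE] := hom_lift_source hP hE.
have [|F [FF FX cF]] := residue_idem lift (X := X).
  by rewrite map_mxM XE EE.
rewrite -XE -FX.
have [g|->|->] := indecomposable_idempotent indP _ FF; first exact/cF/hX.
  by left; rewrite raddf0.
by right; rewrite map_scalar_mx rmorph1.
Qed.

(** Nakayama's lemma for the image of OG in the matrix algebra: lifts of the matrix
units are the rows of a square matrix whose reduction is the identity. *)
Lemma spanning_lift n (P : gmod O G n) : spanning (map_repr red P) -> spanning P.
Proof.
move=> spP.
have /choice[b bE] : forall l : 'I_(n * n), exists x : galg O G,
    map_mx red (galg_act P x) = vec_mx (delta_mx 0 l).
  move=> l; have [x xE] := spP (vec_mx (delta_mx 0 l)).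
  have [f fK] := choice (residue_surj lift).
  exists [ffun g => f (x g)]; rewrite -xE /galg_act raddf_sum.
  by apply: eq_bigr => g _; rewrite /= map_mxZ ffunE fK.
(* Matrices are flattened to rows, so that bases become invertible matrices. *)
pose U := \matrix_(l < n * n) mxvec (galg_act P (b l)).
have uU : U \in unitmx.
  apply: lift_unitmx; suff -> : map_mx red U = 1%:M by apply: unitmx1.
  apply/row_matrixP=> l; rewrite -map_row rowK map_mxvec bE vec_mxK.
  by rewrite row1.
move=> X; pose w := mxvec X *m invmx U.
exists (\sum_l w 0 l *: b l).
rewrite (big_morph (galg_act P) (galg_actD P) (galg_act0 P)).
apply: (can_inj mxvecK); rewrite -[RHS](mulmxKV uU) -/w mulmx_sum_row.
by rewrite raddf_sum; apply: eq_bigr => l _; rewrite rowK galg_actZ /= linearZ.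
Qed.
End Lifting.

(** * Decompositions, simple submodules and simple blocks *)

Section Decomposition.
Variables (O : idomainType) (G : finGroupType).

Lemma decomposition_exists m (M : gmod O G m) :
  exists r (d : 'I_r -> nat) (V : forall i, gmod O G (d i)), decomposition M V.
Proof.
elim/ltn_ind: m M => m IH M.
have [m0|m_gt0] := posnP m.
  exists 0%N, (fun _ => 0%N), (fun i : 'I_0 => False_rect _ (notF (ltn_ord i))).
  split=> [[]//|]; apply/mod_iso_dsum.
  exists (fun _ => 0), (fun _ => 0); split=> [[]//|[]//||[]//|[]//].
  by rewrite big_ord0; subst m; rewrite [RHS]flatmx0.
have [indM|nindM] := pselect (indecomposable M).
  exists 1%N, (fun _ => m), (fun _ => M); split=> //; apply/mod_iso_dsum.
  exists (fun _ => 1%:M), (fun _ => 1%:M); split.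
  - by move=> _; apply: intertwines1.
  - by move=> _; apply: intertwines1.
  - by rewrite big_ord1 mulmx1.
  - by move=> _; rewrite mulmx1.
  - by move=> i j; rewrite !ord1.
have [n1 [n2 [V [W [iso n1_0 n2_0]]]]] : exists n1 n2 (V : gmod O G n1)
    (W : gmod O G n2), [/\ mod_iso M (dadd V W), n1 <> 0%N & n2 <> 0%N].
  apply: contrapT => nX; apply: nindM; split=> // n1 n2 V W iso.
  by apply: contrapT => /not_orP[n1_0 n2_0]; apply: nX; exists n1, n2, V, W.
have le_m : (n1 + n2 <= m)%N.
  by have /mod_isoP[A [B [_ BA _]]] := iso; apply: mulmx1_min BA.
have [|r1 [d1 [V1 [ind1 /mod_iso_dsum[a1 [b1 [ha1 hb1 ba1 ab1 ab10]]]]]]] := IH n1 _ V.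
  by lia.
have [|r2 [d2 [V2 [ind2 /mod_iso_dsum[a2 [b2 [ha2 hb2 ba2 ab2 ab20]]]]]]] := IH n2 _ W.
  by lia.
have [a [b [a' [b' [[ha hb ha' hb'] [ab ab' abz abz' ba]]]]]] := mod_iso_dadd iso.
(* The summands of the two halves are indexed by a sum type, which enum_val turns
   into an ordinal type. *)
pose T : finType := ('I_r1 + 'I_r2)%type.
pose d (x : T) := match x with inl i => d1 i | inr i => d2 i end.
pose U (x : T) : gmod O G (d x) :=
  match x with inl i => V1 i | inr i => V2 i end.
pose p (x : T) : 'M[O]_(d x, m) :=
  match x with inl i => a1 i *m a | inr i => a2 i *m a' end.
pose q (x : T) : 'M[O]_(m, d x) :=
  match x with inl i => b *m b1 i | inr i => b' *m b2 i end.
exists #|T|, (fun i => d (enum_val i)), (fun i => U (enum_val i)); split.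
  by move=> i; case: (enum_val i) => j; [apply: ind1 | apply: ind2].
apply/mod_iso_dsum; exists (fun i => p (enum_val i)), (fun i => q (enum_val i)).
split.
- move=> i; case: (enum_val i) => j /=.
    exact: intertwines_mul (ha1 j) ha.
  exact: intertwines_mul (ha2 j) ha'.
- move=> i; case: (enum_val i) => j /=.
    exact: intertwines_mul hb (hb1 j).
  exact: intertwines_mul hb' (hb2 j).
- rewrite -(big_enum_val (fun x => q x *m p x)) big_sumType /= -[RHS]ba.
  congr (_ + _).
    rewrite -[b in RHS]mulmx1 -ba1 mulmx_sumr mulmx_suml.
    by apply: eq_bigr => i _; rewrite !mulmxA.
  rewrite -[b' in RHS]mulmx1 -ba2 mulmx_sumr mulmx_suml.
  by apply: eq_bigr => i _; rewrite !mulmxA.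
- move=> i; case: (enum_val i) => j /=.
    by rewrite mulmxA -(mulmxA _ a) ab mulmx1.
  by rewrite mulmxA -(mulmxA _ a') ab' mulmx1.
move=> i j; rewrite -(inj_eq enum_val_inj).
case: (enum_val i) => i'; case: (enum_val j) => j' /= ij.
- by rewrite mulmxA -(mulmxA _ a) ab mulmx1 ab10.
- by rewrite mulmxA -(mulmxA _ a) abz mulmx0 mul0mx.
- by rewrite mulmxA -(mulmxA _ a') abz' mulmx0 mul0mx.
by rewrite mulmxA -(mulmxA _ a') ab' mulmx1 ab20.
Qed.
End Decomposition.

Section Residue.
Variables (k : closedFieldType) (G : finGroupType).

Lemma simple_submodule n (W : gmod k G n) : (0 < n)%N ->
  exists m (N : gmod k G m) A,
    [/\ mx_irreducible N, intertwines N W A & A != 0].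
Proof.
move=> n_gt0.
have [||V simV _] := @dec_mxsimple_exists _ _ _ _ W 1%:M.
- exact: mxmodule1.
- rewrite -mxrank_eq0 mxrank1; lia.
have [modV V0 _] := simV.
have irrN : mx_irreducible (submod_repr modV) by apply/submod_mx_irr.
exists _, (submod_repr modV), (val_submod 1%:M); split=> //.
  by move=> g; rewrite -val_submodE -[X in val_submod X]mul1mx val_submodJ ?inE.
by rewrite val_submod_eq0 -mxrank_eq0 mxrank1 mxrank_eq0.
Qed.

Lemma schur_higman n (N : gmod k G n) c :
  (0 < n)%N -> c != 0 -> schur_rel N c -> higman N.
Proof.
move=> n_gt0 c0 sc; pose i0 := Ordinal n_gt0.
exists (c^-1 *: delta_mx i0 i0); rewrite sc mxtraceZ.
suff -> : \tr (delta_mx i0 i0 : 'M[k]_n) = 1 by rewrite mulr1 divff.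
rewrite /mxtrace (bigD1 i0) //= big1 ?addr0 => [|i ii]; rewrite mxE ?eqxx //.
by rewrite (negPf ii).
Qed.

(** A simple projective module is injective: average a linear retraction. *)
Lemma irr_retract n m (N : gmod k G n) (W : gmod k G m) A :
  mx_irreducible N -> higman N -> intertwines N W A -> A != 0 ->
  exists2 B, intertwines W N B & A *m B = 1%:M.
Proof.
move=> irrN [T T1] hA A0.
have /row_freeP[B AB] := irr_intertwines irrN hA A0.
exists (gtrace W N (B *m T)); first exact: gtraceP.
by rewrite (gtrace_mull _ _ hA) mulmxA AB mul1mx.
Qed.

Lemma iso_schur n m (N : gmod k G n) (W : gmod k G m) A B c :
  intertwines N W A -> intertwines W N B -> B *m A = 1%:M ->
  schur_rel N c -> schur_rel W c.
Proof.
move=> hA hB BA sc X.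
have -> : gtrace W W X = B *m gtrace N N (A *m X *m B) *m A.
  rewrite (gtrace_mull _ _ hB) (gtrace_mulr _ _ hA).
  by rewrite !mulmxA BA mul1mx -mulmxA BA mulmx1.
by rewrite sc mul_mx_scalar -scalemxAl BA scalemx1 mxtrace_mulC mulmxA BA mul1mx.
Qed.

Lemma iso_form n m (N : gmod k G n) (W : gmod k G m) A B :
  intertwines N W A -> intertwines W N B -> A *m B = 1%:M ->
  has_projective_form N -> has_projective_form W.
Proof.
move=> hA hB AB [Y S0].
have tr n1 n2 (U : gmod k G n1) (V : gmod k G n2) C :
    intertwines U V C -> intertwines (dual V) (dual U) C^T.
  by move=> hC g; rewrite !dualE -!trmx_mul hC.
exists (B *m Y *m B^T).
rewrite -(gtrace_mulr _ _ (tr _ _ _ _ _ hB)) -(gtrace_mull _ _ hB).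
apply: contraNneq S0 => E.
have := congr1 (fun X => A *m X *m A^T) E.
rewrite mulmx0 mul0mx !mulmxA AB mul1mx -mulmxA -trmx_mul AB trmx1 mulmx1.
by move=> ->.
Qed.

Lemma galg_act_intertwines n m (N : gmod k G n) (W : gmod k G m) A x :
  intertwines N W A -> galg_act N x *m A = A *m galg_act W x.
Proof.
move=> hA; rewrite /galg_act mulmx_sumr mulmx_suml; apply: eq_bigr => g _.
by rewrite -scalemxAl -scalemxAr hA.
Qed.

Section SimpleBlock.
Local Open Scope classical_set_scope.
Variables (n : nat) (N : gmod k G n) (B : set (galg k G)) (e : galg k G).
Hypotheses (irrN : mx_irreducible N) (idB : ideal_of setT B).
Hypotheses (simB : simple_algebra B) (Be : B e).
Hypothesis Ne : galg_act N e = 1%:M.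

Let n_gt0 := irr_gt0 irrN.
Let i0 := Ordinal n_gt0.

(** The elements of B that kill N form an ideal of B, which does not contain e. *)
Lemma simple_block_faithful b : B b -> galg_act N b = 0 -> b = 0.
Proof.
have [_ _ BD BZ BM] := idB.
pose I := [set b | B b /\ galg_act N b = 0].
have idI : ideal_of B I.
  split.
  - by move=> x [].
  - by split; [have [] := idB | rewrite galg_act0].
  - by move=> x y [Bx x0] [By y0]; split; [apply: BD | rewrite galg_actD x0 y0 addr0].
  - by move=> a x [Bx x0]; split; [apply: BZ | rewrite galg_actZ x0 scaler0].
  move=> c x Bc [Bx x0]; have [Bcx Bxc] := BM c x Logic.I Bx.
  by split; split=> //; rewrite galg_actM x0 ?mulmx0 ?mul0mx.
move=> Bb b0; have [_ /(_ _ idI)[E|E]] := simB.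
  by have : I b by []; rewrite E.
have [_] : I e by rewrite E.
rewrite Ne => /matrixP/(_ i0 i0); rewrite !mxE eqxx => /eqP.
by rewrite oner_eq0.
Qed.

Lemma simple_block_trace : B (trace_elt N 1%:M).
Proof.
have [_ _ _ _ BM] := idB.
have [_] := BM (trace_elt N 1%:M) e Logic.I Be.
by rewrite trace_elt_mull Ne mulmx1.
Qed.

(** If the Schur constant were 0, the element trace_elt N 1 of B would kill N, hence
vanish; then the character of N would be 0, and so would the trace of every
matrix. *)
Lemma simple_block_schur : exists2 c, c != 0 & schur_rel N c.
Proof.
have spN := irr_spanning irrN.
have [c sc] := spanning_schur_rel n_gt0 spN; exists c => //.
apply/eqP=> c0; have t0 : trace_elt N 1%:M = 0.
  apply: simple_block_faithful simple_block_trace _.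
  by rewrite (trace_elt_act _ sc) c0 scale0r.
have tr0 g : \tr (N g) = 0.
  have := congr1 (fun x : galg k G => x g^-1%g) t0.
  by rewrite !ffunE invgK mul1mx.
have : \tr (delta_mx i0 i0 : 'M[k]_n) = 0.
  have [x <-] := spN (delta_mx i0 i0); rewrite /galg_act raddf_sum big1 // => g _.
  by rewrite /= mxtraceZ tr0 mulr0.
rewrite /mxtrace (bigD1 i0) //= big1 ?addr0 => [|i ii]; rewrite mxE ?eqxx //.
  by move/eqP; rewrite oner_eq0.
by rewrite (negPf ii).
Qed.

(** By faithfulness e is the multiple of trace_elt N 1 that acts as 1, so the symmetry
of e says that the character is the same at g and g^-1.  If every trace form were
zero, then the sum of tr(N(g)) N(g) would be zero; but by that symmetry it equals
the sum of tr(N(g)^-1) N(g), a nonzero scalar matrix. *)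
Lemma simple_block_form : galg_inv e = e -> has_projective_form N.
Proof.
move=> einv; have [c c0 sc] := simple_block_schur.
have [_ _ BD BZ _] := idB.
have defe : e = c^-1 *: trace_elt N 1%:M.
  apply/eqP; rewrite -subr_eq0 -scaleN1r; apply/eqP.
  apply: simple_block_faithful.
    by apply/BD/BZ/BZ/simple_block_trace.
  rewrite galg_actD !galg_actZ Ne (trace_elt_act _ sc) (scalerA c^-1).
  by rewrite mulVf // scale1r scaleN1r subrr.
have trV g : \tr (N g^-1%g) = \tr (N g).
  have := congr1 (fun x : galg k G => c *: x g) einv.
  rewrite !ffunE defe !ffunE invgK !mul1mx /= !scalerA divff // !scale1r.
  by [].
apply: contrapT => nform.
have form0 Y : gtrace N (dual N) Y = 0.
  by apply/eqP/negPn/negP=> nz; apply: nform; exists Y.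
have : galg_act N (trace_elt N 1%:M) i0 i0 = 0.
  rewrite /galg_act summxE.
  transitivity (\sum_l (gtrace N (dual N) (delta_mx l i0)) l i0).
    under [RHS]eq_bigr do rewrite /gtrace summxE.
    rewrite exchange_big; apply: eq_bigr => g _ /=.
    rewrite mxE ffunE mul1mx trV mulr_suml; apply: eq_bigr => l _.
    rewrite mxE (bigD1 i0) //= big1 ?addr0 => [|m mi].
      by rewrite mul_mx_delta eqxx mulr1n /dual_mx invgK mxE.
    by rewrite mul_mx_delta (negPf mi) mul0r.
  by rewrite big1 // => l _; rewrite form0 mxE.
rewrite (trace_elt_act _ sc) !mxE eqxx mulr1 => /eqP.
by rewrite (negPf c0).
Qed.
End SimpleBlock.
End Residue.

(** * Projective modules whose reduction carries a form *)

Section Generic.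
Variables (O : idomainType) (k : closedFieldType) (red : {rmorphism O -> k}).
Hypotheses (lift : idempotent_lifting red) (k2 : 2%N \in [pchar k]).
Variable G : finGroupType.

Notation "P ^red" := (map_repr red P) (at level 2, format "P ^red").

Lemma galg_act_map n (P : gmod O G n) x :
  galg_act P^red (galg_map red x) = map_mx red (galg_act P x).
Proof.
rewrite /galg_act raddf_sum; apply: eq_bigr => g _.
by rewrite /= map_mxZ ffunE.
Qed.

Lemma galg_mapM (x y : galg O G) :
  galg_map red (x * y) = galg_map red x * galg_map red y.
Proof.
apply/ffunP=> g; rewrite !ffunE rmorph_sum; apply: eq_bigr => h _.
by rewrite !ffunE rmorphM.
Qed.

Lemma lift_galg (x : galg k G) : exists y : galg O G, galg_map red y = x.
Proof.
have [f fK] := choice (residue_surj lift).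
by exists [ffun g => f (x g)]; apply/ffunP=> g; rewrite !ffunE fK.
Qed.

Lemma trace_elt_map n (P : gmod O G n) X :
  galg_map red (trace_elt P X) = trace_elt P^red (map_mx red X).
Proof. by apply/ffunP=> g; rewrite !ffunE -map_mxM trace_map_mx. Qed.

Lemma reduced_schur_block n (P : gmod O G n) :
  reduced_block red (schur_block P) = schur_block P^red.
Proof.
apply/seteqP; split=> [_ [_ [X _ <-] <-]|_ [X _ <-]].
  by exists (map_mx red X); rewrite ?trace_elt_map.
have [Y <-] := lift_mx lift X; exists (trace_elt P Y); first by exists Y.
exact: trace_elt_map.
Qed.

(** A simple projective submodule of the reduction of an indecomposable projective
module is the whole reduction. *)
Lemma irr_submodule_full n m (P : gmod O G n) (N : gmod k G m) A :
  indecomposable P -> higman P -> mx_irreducible N -> higman N ->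
  intertwines N P^red A -> A != 0 ->
  exists2 B, intertwines P^red N B & A *m B = 1%:M /\ B *m A = 1%:M.
Proof.
move=> indP hP irrN hN hA A0.
have [B hB AB] := irr_retract irrN hN hA A0; exists B => //; split=> //.
have [||E0|//] := @indecomposable_red_idempotent _ _ _ lift _ _ P (B *m A) indP hP.
- exact: intertwines_mul hB hA.
- by rewrite mulmxA -(mulmxA B) AB mulmx1.
by case/eqP: A0; rewrite -[A]mul1mx -AB -mulmxA E0 mulmx0.
Qed.

(** The column at the coset of x is fixed by C(t) conjugated by x, the centralizer of
another involution; this avoids moving columns back to t. *)
Lemma induced_fixed (t : G) n (P : gmod O G n) a i :
  intertwines P (induced (trivial_mod O 'C[t]%G)) a ->
  fixed_by 'C[t ^ coset_rep i] P^red (map_mx red (submxrow a i)).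
Proof.
move=> ha h /cent1P Ch; rewrite /= -map_mxM; congr map_mx.
apply: (induced_col ha); apply/cent1P; set x := coset_rep i in Ch *.
have -> : (x * h * x^-1 = h ^ x^-1)%g by rewrite conjgE invgK mulgA.
have := congr1 (conjg^~ x^-1%g) Ch.
by rewrite /= (conjMg h) (conjMg _ h) conjgK.
Qed.

Lemma involution_conj (t x : G) : (t * t)%g = 1%g -> (t ^ x * t ^ x)%g = 1%g.
Proof. by rewrite -conjMg => ->; rewrite conj1g. Qed.

Lemma nonzero_col n q (r : 'I_q -> nat) (A : 'M[k]_(n, \sum_i r i)) :
  A != 0 -> exists i, submxrow A i != 0.
Proof.
move=> A0; apply: contrapT => nX; case/eqP: A0.
rewrite -[A]submxrowK -[RHS]submxrowK; apply: eq_mxrow => i.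
rewrite submxrow0; apply/eqP/negPn/negP=> nz.
by apply: nX; exists i.
Qed.

Lemma map_submxrow n q (r : 'I_q -> nat) (A : 'M[O]_(n, \sum_i r i)) i :
  map_mx red (submxrow A i) = submxrow (map_mx red A) i.
Proof. by apply/matrixP=> x y; rewrite !mxE. Qed.

(** As the embedding of P into the induced module is injective on a simple submodule N
of the reduction, one of its columns does not vanish on N. *)
Lemma summand_form (t : G) n (P : gmod O G n) :
  (t * t)%g = 1%g -> indecomposable P -> higman P ->
  direct_summand P (induced (trivial_mod O 'C[t]%G)) ->
  mx_irreducible P^red /\ has_projective_form P^red.
Proof.
move=> t2 indP hP /direct_summand_retract[a [b [ha hb ab]]].
have n_gt0 : (0 < n)%N by case: indP.
have [m [N [A [irrN hA A0]]]] := simple_submodule P^red n_gt0.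
have [|i Ai] := @nonzero_col _ _ _ (A *m map_mx red a).
  apply: contraNneq A0 => Aa0.
  by rewrite -[A]mulmx1 -(map_mx1 red) -ab map_mxM mulmxA Aa0 mul0mx.
rewrite -mul_submxrow -map_submxrow in Ai.
have formN : has_projective_form N.
  have t2' := involution_conj (coset_rep i) t2.
  have fixu := induced_fixed (i := i) ha.
  by have := submodule_form k2 t2' (higman_map red hP) hA fixu Ai.
have hN := form_higman irrN formN.
have [B hB [AB BA]] := irr_submodule_full indP hP irrN hN hA A0.
have [c c0 sc] := form_schur irrN formN; split.
  exact: schur_irreducible n_gt0 c0 (iso_schur hA hB BA sc).
exact: iso_form hA hB AB formN.
Qed.

(** Reality of B makes its identity symmetric: the inverse image of the identity is
again an identity of B. *)
Lemma block_form n (M : gmod O G n) (B : set (galg O G)) :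
  indecomposable M -> higman M -> is_block B -> real_block B ->
  simple_algebra (reduced_block red B) -> belongs_to M B ->
  mx_irreducible M^red /\ has_projective_form M^red.
Proof.
move=> indM hM [[B' [idB _ _ _]] _] realB simB [e [Be eB Me]].
have n_gt0 : (0 < n)%N by case: indM.
have [m [N [A [irrN hA A0]]]] := simple_submodule M^red n_gt0.
have [_ B0 BD BZ BM] := idB.
have idB' : ideal_of setT (reduced_block red B).
  split=> //.
  - exists 0 => //; apply/ffunP=> g; rewrite !ffunE; apply: raddf0.
  - move=> _ _ [x Bx <-] [y By <-]; exists (x + y); first exact: BD.
    by apply/ffunP=> g; rewrite !ffunE; apply: rmorphD.
  - move=> a _ [x Bx <-]; have [a' <-] := residue_surj lift a.
    exists (a' *: x); first exact: BZ.
    by apply/ffunP=> g; rewrite !ffunE; apply: rmorphM.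
  move=> x _ _ [y By <-]; have [x' <-] := lift_galg x.
  rewrite -!galg_mapM; have [Bxy Byx] := BM x' y I By.
  by split; [exists (x' * y) | exists (y * x')].
pose e' := galg_map red e.
have Be' : reduced_block red B e' by exists e.
have Ne : galg_act N e' = 1%:M.
  have := galg_act_intertwines e' hA.
  rewrite galg_act_map Me map_mx1 mulmx1 -{2}[A]mul1mx => E.
  exact: row_free_inj (irr_intertwines irrN hA A0) _ _ E.
have [c c0 sc] := simple_block_schur irrN idB' simB Be' Ne.
have hN : higman N := schur_higman (irr_gt0 irrN) c0 sc.
have [C hC [AC CA]] := irr_submodule_full indM hM irrN hN hA A0.
split; first exact: schur_irreducible n_gt0 c0 (iso_schur hA hC CA sc).
apply: iso_form hA hC AC _.
apply: simple_block_form irrN idB' simB Be' Ne _.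
have invM (x y : galg O G) : galg_inv (x * y) = galg_inv y * galg_inv x.
  apply/ffunP=> g; rewrite !ffunE.
  rewrite (reindex_inj (mulgI g^-1%g)) /=; apply: eq_bigr => h _.
  by rewrite !ffunE mulrC !invMg !invgK mulgK.
have invK (x : galg O G) : galg_inv (galg_inv x) = x.
  by apply/ffunP=> g; rewrite !ffunE invgK.
have Binv x : B x -> B (galg_inv x) by move=> Bx; rewrite realB; exists x.
have einv : galg_inv e = e.
  have [eb _] := eB _ (Binv _ Be); rewrite -[LHS]eb.
  by rewrite -{1}[e]invK -invM; have [-> _] := eB _ (Binv _ Be); rewrite invK.
by rewrite /e' -{2}einv; apply/ffunP=> g; rewrite !ffunE.
Qed.

Section DefectZero.
Variables (n : nat) (P : gmod O G n).
Hypotheses (hP : higman P) (irrP : mx_irreducible P^red).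
Hypothesis formP : has_projective_form P^red.

Let n_gt0 := irr_gt0 irrP.

Lemma form_lift_schur : exists2 c, c \is a GRing.unit & schur_rel P c.
Proof.
have spP := spanning_lift lift (irr_spanning irrP).
have [c sc] := spanning_schur_rel n_gt0 spP.
by exists c => //; apply: schur_unit n_gt0 sc hP.
Qed.

Lemma form_lift_self_dual : self_dual P.
Proof.
have [Y [S [_ hS Su]]] := projective_formP irrP formP.
have hS' : intertwines P^red (map_repr red (dual P)) S.
  by move=> g; rewrite hS /= /dual_mx map_trmx.
have [S' hS'' redS] := hom_lift_source lift hP hS'.
have S'u : S' \in unitmx by apply: (lift_unitmx lift); rewrite redS.
by apply/mod_isoP; exists S', (invmx S'); rewrite mulmxV ?mulVmx.
Qed.

(** Two homomorphisms whose columns at one coset are proportional are proportional,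
as each column determines the others. *)
Lemma induced_hom_unique (t : G) a a' : (t * t)%g = 1%g ->
  intertwines P (induced (trivial_mod O 'C[t]%G)) a ->
  intertwines P (induced (trivial_mod O 'C[t]%G)) a' ->
  map_mx red a != 0 -> exists l, map_mx red a' = l *: map_mx red a.
Proof.
move=> t2 ha ha' a0; have [i ai] := nonzero_col a0.
rewrite -map_submxrow in ai.
have [Y [S [_ hS Su]]] := projective_formP irrP formP.
have [c c0 sc] := form_schur irrP formP.
have [l El] := form_fixed_unique irrP formP k2 hS Su sc
  (involution_conj (coset_rep i) t2) (induced_fixed ha) (induced_fixed ha') ai.
exists l; rewrite -[LHS]submxrowK -[RHS]submxrowK; apply: eq_mxrow => j.
have H : (coset_rep j * ((coset_rep j)^-1 * coset_rep i) * (coset_rep i)^-1)%g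
    \in 'C[t]%G by rewrite mulgA mulgV mul1g mulgV group1.
rewrite -map_submxrow -(induced_col ha' H) map_mxM El -scalemxAr -map_mxM.
rewrite (induced_col ha H) map_submxrow.
by apply/matrixP=> p q; rewrite !mxE.
Qed.

(** The identity of P factors through the sum of the V i; each summand contributes a
scalar to the reduction, so P is a retract of some V i, which is indecomposable.
Two such indices would give two homomorphisms to the induced module whose
reductions are linearly independent, against induced_hom_unique. *)
Lemma form_multiplicity (t : G) : (t * t)%g = 1%g ->
  direct_summand P (induced (trivial_mod O 'C[t]%G)) ->
  multiplicity P (induced (trivial_mod O 'C[t]%G)) 1.
Proof.
move=> t2 /direct_summand_retract[a [b [ha hb ab]]].
split; first exact: decomposition_exists.
move=> r d V [indV /mod_iso_dsum[al [be [hal hbe bal alb albe0]]]].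
pose z i := map_mx red (a *m be i *m (al i *m b)).
have scal i : exists s, z i = s%:M.
  have hz : intertwines P^red P^red (z i).
    apply: intertwines_map; apply: intertwines_mul.
      exact: intertwines_mul ha (hbe i).
    exact: intertwines_mul (hal i) hb.
  exists (z i (Ordinal n_gt0) (Ordinal n_gt0)); apply: central_scalar_mx => Y.
  have [x <-] := irr_spanning irrP Y.
  by rewrite (galg_act_intertwines x hz).
have sumz : \sum_i z i = 1%:M.
  rewrite -(map_mx1 red) -ab -[a]mulmx1 -bal mulmx_sumr mulmx_suml raddf_sum.
  by apply: eq_bigr => i _; rewrite /z !mulmxA.
have [i zi] : exists i, z i != 0.
  apply: contrapT => nX; have : (1%:M : 'M[k]_n) = 0.
    rewrite -sumz big1 // => i _; apply/eqP/negPn/negP=> nz.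
    by apply: nX; exists i.
  move/matrixP/(_ (Ordinal n_gt0) (Ordinal n_gt0)).
  by rewrite !mxE eqxx => /eqP; rewrite oner_eq0.
have Vi : mod_iso (V i) P.
  apply: (retract_indecomposable lift n_gt0 (indV i)
    (intertwines_mul ha (hbe i)) (intertwines_mul (hal i) hb)).
  apply: (lift_unitmx lift); rewrite -/(z i).
  have [s zE] := scal i; rewrite zE in zi *.
  rewrite -scalemx1 unitmxZ ?unitmx1 // unitfE.
  by apply: contraNneq zi => ->; rewrite raddf0.
exists [set i]%SET; split=> [|j]; first by rewrite cards1.
rewrite inE; split=> [/eqP->//|Vj]; apply/negPn/negP=> ji.
have iso_hom l : mod_iso (V l) P -> exists a' b',
    intertwines P (induced (trivial_mod O 'C[t]%G)) (a' *m al l) /\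
    a' *m b' = 1%:M :> 'M_n.
  move=> /mod_isoP[A [B [AB BA hA]]]; exists B, A; split=> //.
  exact: intertwines_mul (intertwines_inv AB BA hA) (hal l).
have [ai [bi [hi abi]]] := iso_hom _ Vi.
have [aj [bj [hj abj]]] := iso_hom _ Vj.
have orth l l' (x : 'M_(n, d l)) (y : 'M_(d l', n)) :
    x *m al l *m (be l' *m y) = x *m (al l *m be l') *m y.
  by rewrite !mulmxA.
have ai0 : map_mx red (ai *m al i) != 0.
  apply/eqP=> E.
  have : map_mx red (ai *m al i *m (be i *m bi)) = 0 by rewrite map_mxM E mul0mx.
  rewrite orth alb mulmx1 abi map_mx1.
  move/matrixP/(_ (Ordinal n_gt0) (Ordinal n_gt0)).
  by rewrite !mxE eqxx => /eqP; rewrite oner_eq0.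
have [l El] := induced_hom_unique t2 hi hj ai0.
have : map_mx red (aj *m al j *m (be j *m bj)) = 0.
  rewrite map_mxM El -scalemxAl -map_mxM orth albe0; last by rewrite eq_sym.
  by rewrite mulmx0 mul0mx raddf0 scaler0.
rewrite orth alb mulmx1 abj map_mx1.
move/matrixP/(_ (Ordinal n_gt0) (Ordinal n_gt0)).
by rewrite !mxE eqxx => /eqP; rewrite oner_eq0.
Qed.

Lemma form_block : exists B : set (galg O G),
  [/\ is_block B, real_block B, simple_algebra (reduced_block red B) &
      belongs_to P B].
Proof.
have [c cu sc] := form_lift_schur; exists (schur_block P); split.
- exact: schur_block_is_block n_gt0 cu sc.
- exact: schur_block_real form_lift_self_dual.
- rewrite reduced_schur_block.
  apply: (schur_block_simple n_gt0 _ (schur_map red sc)).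
  by rewrite -unitfE; apply: rmorph_unit.
exact: schur_block_belongs cu sc.
Qed.

(** A nonzero vector fixed by C(s) in the reduction is a trace over C(s), hence lifts
to a fixed vector; the homomorphism that it defines has an injective reduction,
which splits. *)
Lemma form_involution_exists : exists2 s : G, (s * s)%g = 1%g &
  direct_summand P (induced (trivial_mod O 'C[s]%G)).
Proof.
have [Y [S [_ hS Su]]] := projective_formP irrP formP.
have [c c0 sc] := form_schur irrP formP.
have [s [u [s2 u0 fu]]] := form_fixed_exists irrP k2 hS Su c0 sc.
exists s => //.
have [y def_u] := fixed_trace (C := 'C[s]%G) (higman_map _ hP) fu.
have [y' redy] := lift_mx lift y.
pose u' := \sum_(h in 'C[s]%G) P h *m y'.
have redu : map_mx red u' = u.
  rewrite def_u raddf_sum; apply: eq_bigr => h _.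
  by rewrite /= map_mxM redy.
have fu' : fixed_by 'C[s]%G P u'.
  move=> h Ch; rewrite /u' mulmx_sumr [RHS](reindex_inj (mulgI h)).
  apply: eq_big => [g|g _]; first by rewrite groupMl.
  by rewrite mulmxA gmodM.
have [a ha acol] := induced_hom fu'.
have a0 : map_mx red a != 0.
  have [i _] := coset_rep_ex 'C[s]%G 1%g.
  apply: contraNneq u0 => a0.
  have := map_submxrow a i; rewrite a0 submxrow0 acol map_mxM redu.
  move/(congr1 (mulmx (P^red (coset_rep i)))).
  by rewrite mulmx0 mulmxA -map_mxM gmodVK map_mx1 mul1mx => ->.
have /row_freeP[r ar] := irr_intertwines irrP (intertwines_map red ha) a0.
have [r' redr] := lift_mx lift r; have [T T1] := hP.
apply: (retract_summand lift ha (gtraceP _ _ (r' *m T))).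
apply: (lift_unitmx lift); rewrite (gtrace_mull _ _ ha) map_gtrace !map_mxM redr.
by rewrite mulmxA ar mul1mx -map_gtrace T1 map_mx1 unitmx1.
Qed.

Lemma form_involution_unique (s s' : G) :
  (s * s)%g = 1%g -> (s' * s')%g = 1%g ->
  direct_summand P (induced (trivial_mod O 'C[s]%G)) ->
  direct_summand P (induced (trivial_mod O 'C[s']%G)) ->
  exists g, s' = (s ^ g)%g.
Proof.
have col (t : G) : direct_summand P (induced (trivial_mod O 'C[t]%G)) ->
    exists x (u : 'cV_n), u != 0 /\ fixed_by 'C[t ^ x] P^red u.
  move=> /direct_summand_retract[a [b [ha hb ab]]].
  have a0 : map_mx red a != 0.
    apply/eqP=> E; have : map_mx red (a *m b) = 0 by rewrite map_mxM E mul0mx.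
    rewrite ab map_mx1 => /matrixP/(_ (Ordinal n_gt0) (Ordinal n_gt0)).
    by rewrite !mxE eqxx => /eqP; rewrite oner_eq0.
  have [i ai] := nonzero_col a0; rewrite -map_submxrow in ai.
  by exists (coset_rep i), (map_mx red (submxrow a i)); split=> //; apply: induced_fixed.
move=> s2 s2' /col[x [u [u0 fu]]] /col[x' [u' [u0' fu']]].
have [Y [S [_ hS Su]]] := projective_formP irrP formP.
have [c c0 sc] := form_schur irrP formP.
have [g Eg] := form_fixed_conj irrP formP k2 hS Su c0 sc
  (involution_conj x s2) (involution_conj x' s2') fu fu' u0 u0'.
exists (x * g * x'^-1)%g.
by rewrite !conjgM -Eg conjgK.
Qed.
End DefectZero.
End Generic.

(** * Lifting idempotents over a complete discrete valuation ring *)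

Lemma idempotent_lifting_id (k : fieldType) :
  idempotent_lifting (idfun : {rmorphism k -> k}).
Proof.
split=> [a|x|n X]; first by exists a.
  by rewrite unitfE.
have id_mx (A : 'M[k]_n) : map_mx (idfun : {rmorphism k -> k}) A = A.
  by apply/matrixP=> i j; rewrite mxE.
by rewrite !id_mx => XX; exists X.
Qed.

Section Newton.
Variables (R : comNzRingType) (n : nat) (X : 'M[R]_n.+1).
Let D := X ^+ 2 - X.
(** This is 3X^2 - 2X^3, the Newton iteration for X^2 = X, written with the defect D
so that its divisibility properties are visible. *)
Definition newton_step : 'M[R]_n.+1 := X + D - 2%:R * (X * D).

(** The identity takes place in the subalgebra generated by X, so it is the image of
one between polynomials. *)
Lemma newton_idem : newton_step ^+ 2 - newton_step = D ^+ 2 * (4%:R * D - 3%:R).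
Proof.
pose q : {poly R} := 'X^2 - 'X.
pose y := 'X + q - 2%:R * ('X * q).
have id : y ^+ 2 - y = q ^+ 2 * (4%:R * q - 3%:R) by rewrite /y /q; ring.
have qE : horner_mx X q = D by rewrite /q rmorphB rmorphXn /= horner_mx_X.
clearbody q; have yE : horner_mx X y = newton_step.
  by rewrite /y rmorphB rmorphD !rmorphM rmorph_nat /= qE horner_mx_X.
clearbody y; have := congr1 (horner_mx X) id.
rewrite rmorphB rmorphXn [X in _ = X]rmorphM rmorphXn rmorphB [X in _ = _ * (X - _)]rmorphM.
by rewrite !rmorph_nat /= yE qE.
Qed.

Lemma newton_comm (Z : 'M[R]_n.+1) : GRing.comm Z X -> GRing.comm Z newton_step.
Proof.
move=> ZX; have ZD : GRing.comm Z D by apply/commrB/ZX/commrX.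
apply: commrB; first exact: commrD.
by apply: commrM; [apply: commr_nat | apply: commrM].
Qed.
End Newton.

Section Dvr.
Variables (R : idomainType) (k : fieldType) (red : {rmorphism R -> k}).
Hypotheses (resR : is_residue_map red) (p : R).
Hypotheses (unif : is_uniformizer p) (complete : adic_complete p).

Lemma red_unif : red p = 0.
Proof. by have [_ pnu _] := unif; apply/(proj2 resR). Qed.

Lemma red0_div x : red x = 0 -> exists c, x = c * p.
Proof.
have [_ _ dec] := unif => x0; have [->|xn0] := eqVneq x 0.
  by exists 0; rewrite mul0r.
have [u [[|m] [uu xE]]] := dec x xn0.
  by move/(proj2 resR): x0; rewrite xE mulr1 uu.
by exists (u * p ^+ m); rewrite xE exprSr mulrA.
Qed.

(** If x = u p^m with u a unit were divisible by p^(m+1), then p would divide u. *)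
Lemma adic_separated x : (forall m, exists c, x = c * p ^+ m) -> x = 0.
Proof.
have [p0 pnu dec] := unif => div; apply/eqP/negPn/negP=> x0.
have [u [m [uu xE]]] := dec x x0; have [c] := div m.+1.
rewrite xE exprS mulrA => /(mulIf (expf_neq0 m p0)) uE.
by move: uu; rewrite uE unitrM (negPf pnu) andbF.
Qed.

Definition cong_mx a b m (X Y : 'M[R]_(a, b)) := exists C, X - Y = p ^+ m *: C.

Section Cong.
Variables a b : nat.
Implicit Types X Y Z : 'M[R]_(a, b).

Lemma cong_mxP m X Y :
  (forall i j, adic_cong p m (X i j) (Y i j)) -> cong_mx m X Y.
Proof.
move=> H; have /choice[f fE] : forall ij : 'I_a * 'I_b,
    exists c, X ij.1 ij.2 - Y ij.1 ij.2 = c * p ^+ m by case.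
exists (\matrix_(i, j) f (i, j)); apply/matrixP=> i j.
by rewrite !mxE mulrC -(fE (i, j)).
Qed.

Lemma cong_mx_entry m X Y i j : cong_mx m X Y -> adic_cong p m (X i j) (Y i j).
Proof.
by move=> [C /matrixP/(_ i j)]; rewrite !mxE => E; exists (C i j); rewrite E mulrC.
Qed.

Lemma cong_mx_sym m X Y : cong_mx m X Y -> cong_mx m Y X.
Proof. by move=> [C E]; exists (- C); rewrite scalerN -E opprB. Qed.

Lemma cong_mx_trans m X Y Z : cong_mx m X Y -> cong_mx m Y Z -> cong_mx m X Z.
Proof.
by move=> [C E] [C' E']; exists (C + C'); rewrite scalerDr -E -E' addrA subrK.
Qed.

Lemma cong_mx_le m m' X Y : (m <= m')%N -> cong_mx m' X Y -> cong_mx m X Y.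
Proof.
move=> le_m [C E]; exists (p ^+ (m' - m) *: C).
by rewrite scalerA -exprD subnKC.
Qed.

Lemma cong_mx_eq X Y : (forall m, cong_mx m X Y) -> X = Y.
Proof.
move=> cXY; apply/matrixP=> i j; apply/eqP; rewrite -subr_eq0; apply/eqP.
by apply: adic_separated => m; apply: cong_mx_entry.
Qed.

Lemma cong_mx_red m X Y : cong_mx m.+1 X Y -> map_mx red X = map_mx red Y.
Proof.
move=> [C E]; apply/eqP; rewrite -subr_eq0 -map_mxB E map_mxZ.
by rewrite exprS rmorphM red_unif mul0r scale0r.
Qed.

(** Entrywise completeness; the finitely many moduli of convergence have a maximum. *)
Lemma cong_mx_limit (X : nat -> 'M[R]_(a, b)) :
  (forall j, cong_mx j.+1 (X j.+1) (X j)) ->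
  exists L, forall m, exists j, (m <= j)%N /\ cong_mx m (X j) L.
Proof.
move=> step.
have near i j m : (m <= i)%N -> (i <= j)%N -> cong_mx m (X i) (X j).
  move=> le_mi; elim: j => [|j IH]; first by case: i le_mi => // _ _; exists 0; rewrite subrr scaler0.
  rewrite leq_eqVlt ltnS => /orP[/eqP->|le_ij].
    by exists 0; rewrite subrr scaler0.
  apply: cong_mx_trans (IH le_ij) _; apply: cong_mx_sym.
  by apply: cong_mx_le (step j); lia.
have near' i j m : (m <= i)%N -> (m <= j)%N -> cong_mx m (X i) (X j).
  move=> mi mj; have [ij|ji] := leqP i j; first exact: near.
  by apply/cong_mx_sym/near/ltnW.
have /choice[l lE] : forall xy : 'I_a * 'I_b, exists l, forall m,
    exists N, forall i, (N <= i)%N -> adic_cong p m (X i xy.1 xy.2) l.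
  move=> xy; apply: (complete (u := fun i => X i xy.1 xy.2)) => m.
  by exists m => i j mi mj; apply/cong_mx_entry/near'.
exists (\matrix_(x, y) l (x, y)) => m.
have /choice[N NE] : forall xy : 'I_a * 'I_b, exists N, forall i,
    (N <= i)%N -> adic_cong p m (X i xy.1 xy.2) (l xy) by move=> xy; apply: lE.
exists (maxn m (\max_xy N xy)); split; first exact: leq_maxl.
apply: cong_mxP => x y; rewrite mxE; apply: (NE (x, y)).
by apply: leq_trans (leq_maxr _ _); apply: leq_bigmax.
Qed.
End Cong.

Lemma cong_mxM a b c m (X X' : 'M[R]_(a, b)) (Y Y' : 'M[R]_(b, c)) :
  cong_mx m X X' -> cong_mx m Y Y' -> cong_mx m (X *m Y) (X' *m Y').
Proof.
move=> [C E] [C' E']; exists (C *m Y + X' *m C').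
rewrite scalerDr scalemxAl -E scalemxAr -E' mulmxBl mulmxBr.
by rewrite addrA subrK.
Qed.

(** Newton iteration: the j-th iterate is idempotent modulo p^(j+1) and congruent to
the next one modulo p^(j+1), so the iterates converge to an idempotent. *)
Lemma dvr_idempotent_lifting : idempotent_lifting red.
Proof.
split=> [a|x|n X0 XX0]; first by have [s _] := resR; apply: s.
  by move=> rx; apply/negPn/negP=> /(proj2 resR) r0; rewrite r0 eqxx in rx.
case: n X0 XX0 => [|n] X0 XX0.
  by exists X0; split=> //; rewrite [LHS]flatmx0 [RHS]flatmx0.
pose X j := iter j (@newton_step R n) X0.
have idem j : cong_mx j.+1 (X j ^+ 2) (X j).
  elim: j => [|j [C E]].
    apply: cong_mxP => i l; have r0 : red ((X0 *m X0) i l - X0 i l) = 0.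
      by have /matrixP/(_ i l) := XX0; rewrite !mxE rmorphB => ->; rewrite subrr.
    by have [c cE] := red0_div r0; exists c; rewrite expr1 -cE.
  exists (p ^+ j *: (C ^+ 2 * (4%:R * (X j ^+ 2 - X j) - 3%:R))).
  rewrite /X iterS -/(X j) newton_idem E expr2 -scalerAl -scalerAr.
  rewrite -scalerAl -scalerAl !scalerA -!exprD -expr2.
  by congr (p ^+ _ *: _); lia.
have [j|L LE] := @cong_mx_limit _ _ X _.
  have [C E] := idem j; exists (C - 2%:R * (X j * C)).
  rewrite {1}/X iterS -/(X j) /newton_step E addrAC [X j + _]addrC addrK.
  by rewrite scalerBr -!scalerAr.
have comm Y j : Y *m X0 = X0 *m Y -> Y *m X j = X j *m Y.
  by move=> YX; elim: j => //= j IH; apply: newton_comm.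
have redX j : map_mx red (X j) = map_mx red X0.
  elim: j => // j <-; apply: (@cong_mx_red _ _ 0).
  have [C E] := idem j; exists (p ^+ j *: (C - 2%:R * (X j * C))).
  rewrite {1}/X iterS -/(X j) /newton_step E addrAC [X j + _]addrC addrK.
  by rewrite scalerA -exprD add1n scalerBr -!scalerAr.
exists L; split.
- apply: cong_mx_eq => m; have [j [mj cj]] := LE m.
  apply: cong_mx_trans (cong_mx_sym (cong_mxM cj cj)) _.
  apply: cong_mx_trans cj; apply: cong_mx_le (idem j); exact: leqW.
- have [j [_ /cong_mx_red <-]] := LE 1%N; exact: redX.
move=> Y YX; apply: cong_mx_eq => m; have [j [mj cj]] := LE m.
have c0 : cong_mx m Y Y by exists 0; rewrite subrr scaler0.
apply: cong_mx_trans (cong_mx_sym (cong_mxM c0 cj)) _.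
by rewrite comm //; apply: cong_mxM.
Qed.
End Dvr.

(** * The two directions of the correspondence *)

Section Parts.
Variables (O : idomainType) (k : closedFieldType) (red : {rmorphism O -> k}).
Hypotheses (lift : idempotent_lifting red) (k2 : 2%N \in [pchar k]).
Variable G : finGroupType.

Lemma involution_sqr (t : G) : (t ^+ 2)%g = 1%g -> (t * t)%g = 1%g.
Proof. by []. Qed.

Lemma projective_summand_of_involution (t : G) (n : nat) (P : gmod O G n) :
  (t ^+ 2)%g = 1%g -> indecomposable P -> projective P ->
  direct_summand P (induced (trivial_mod O 'C[t]%G)) ->
  [/\ exists2 c, c \is a GRing.unit & schur_rel P c,
      self_dual P, multiplicity P (induced (trivial_mod O 'C[t]%G)) 1 &
      exists B : set (galg O G),
        [/\ is_block B, real_block B, simple_algebra (reduced_block red B) &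
            belongs_to P B]].
Proof.
move=> /involution_sqr t2 indP /projective_higman hP sumP.
have [irrP formP] := summand_form lift k2 t2 indP hP sumP; split.
- exact (form_lift_schur lift hP irrP).
- exact (form_lift_self_dual lift hP irrP formP).
- exact (form_multiplicity lift k2 irrP formP t2 sumP).
exact (form_block lift hP irrP formP).
Qed.

Lemma involution_of_real_block (n : nat) (M : gmod O G n) (B : set (galg O G)) :
  indecomposable M -> projective M ->
  is_block B -> real_block B -> simple_algebra (reduced_block red B) ->
  belongs_to M B ->
  exists s : G,
    [/\ (s ^+ 2)%g = 1%g,
        component M (induced (trivial_mod O 'C[s]%G)) &
        forall s' : G, (s' ^+ 2)%g = 1%g ->
          component M (induced (trivial_mod O 'C[s']%G)) ->
          exists g : G, s' = (s ^ g)%g].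
Proof.
move=> indM /projective_higman hM blB realB simB MB.
have [irrM formM] := block_form lift indM hM blB realB simB MB.
have [s s2 sumM] := form_involution_exists lift k2 hM irrM formM.
exists s; split=> // s' /involution_sqr s2' [_ sumM'].
exact (form_involution_unique k2 irrM formM s2 s2' sumM sumM').
Qed.
End Parts.

Lemma reduced_block_id (k : fieldType) (G : finGroupType) (B : set (galg k G)) :
  reduced_block (idfun : {rmorphism k -> k}) B = B.
Proof.
have mapid (x : galg k G) : galg_map (idfun : {rmorphism k -> k}) x = x.
  by apply/ffunP=> g; rewrite ffunE.
apply/seteqP; split=> [_ [x Bx <-]|x Bx]; first by rewrite mapid.
by exists x; rewrite ?mapid.
Qed.

Theorem theorem8
  (k : closedFieldType) (R : idomainType) (red : {rmorphism R -> k})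
  (G : finGroupType)
  (char_k : 2%N \in [pchar k])
  (char_R : [pchar R] =i pred0)
  (dvr_R : is_complete_dvr R)
  (residue_R : is_residue_map red)
  (split_F : forall H : {group G}, group_splitting_field {fraction R} H) :
  (* (i), O = k *)
  (forall (t : G) (n : nat) (P : gmod k G n),
     (t ^+ 2)%g = 1%g ->
     indecomposable P -> projective P ->
     direct_summand P (induced (trivial_mod k 'C[t]%G)) ->
     [/\ mx_irreducible P, self_dual P,
         multiplicity P (induced (trivial_mod k 'C[t]%G)) 1 &
         exists B : set (galg k G),
           [/\ is_block B, real_block B, simple_algebra B & belongs_to P B]])
  /\
  (* (i), O = R *)
  (forall (t : G) (n : nat) (P : gmod R G n),
     (t ^+ 2)%g = 1%g ->
     indecomposable P -> projective P ->
     direct_summand P (induced (trivial_mod R 'C[t]%G)) ->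
     [/\ frac_irreducible P, self_dual P,
         multiplicity P (induced (trivial_mod R 'C[t]%G)) 1 &
         exists B : set (galg R G),
           [/\ is_block B, real_block B, simple_algebra (reduced_block red B)
             & belongs_to P B]])
  /\
  (* (ii), O = k *)
  (forall (n : nat) (M : gmod k G n) (B : set (galg k G)),
     indecomposable M -> projective M ->
     is_block B -> real_block B -> simple_algebra B -> belongs_to M B ->
     exists s : G,
       [/\ (s ^+ 2)%g = 1%g,
           component M (induced (trivial_mod k 'C[s]%G)) &
           forall s' : G, (s' ^+ 2)%g = 1%g ->
             component M (induced (trivial_mod k 'C[s']%G)) ->
             exists g : G, s' = (s ^ g)%g])
  /\
  (* (ii), O = R *)
  (forall (n : nat) (M : gmod R G n) (B : set (galg R G)),
     indecomposable M -> projective M ->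
     is_block B -> real_block B -> simple_algebra (reduced_block red B) ->
     belongs_to M B ->
     exists s : G,
       [/\ (s ^+ 2)%g = 1%g,
           component M (induced (trivial_mod R 'C[s]%G)) &
           forall s' : G, (s' ^+ 2)%g = 1%g ->
             component M (induced (trivial_mod R 'C[s']%G)) ->
             exists g : G, s' = (s ^ g)%g]).
Proof.
have lift_k := idempotent_lifting_id k.
have lift_R : idempotent_lifting red.
  have [[p unif] complete] := dvr_R.
  exact (dvr_idempotent_lifting residue_R unif (complete p unif)).
split; [|split; [|split]].
- move=> t n P t2 indP prP sumP.
  have [[c cu sc] sd mult [B [blB rB simB PB]]] :=
    projective_summand_of_involution lift_k char_k t2 indP prP sumP.
  split=> //; first by case: indP => n_gt0 _; apply: (schur_irreducible n_gt0 _ sc); rewrite -unitfE.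
  by exists B; rewrite reduced_block_id in simB.
- move=> t n P t2 indP prP sumP.
  have [[c cu sc] sd mult blk] :=
    projective_summand_of_involution lift_R char_k t2 indP prP sumP.
  (* The Schur relations persist over the field of fractions, where a nonzero
     constant forces irreducibility. *)
  split=> //; case: indP => n_gt0 _.
  apply: (schur_irreducible n_gt0 _ (schur_map (@tofrac R) sc)).
  by rewrite -unitfE; apply: rmorph_unit.
- move=> n M B indM prM blB rB simB MB.
  apply: (involution_of_real_block lift_k char_k indM prM blB rB _ MB).
  by rewrite reduced_block_id.
move=> n M B; exact: involution_of_real_block.
Qed.
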